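(* Let $m>4$ be an integer, let $B^m\subset\mathbb{R}^m$ be the unit ball, and let $u=(u_{ij})_{1\le i,j\le m}\colon B^m\to\mathbb{S}^{m^2-1}\subset\mathbb{R}^{m^2}$ be the map $$u_{ij}(x)=\frac{1}{\sqrt{m(m-1)}}\Big(-\delta_{ij}+m\frac{x_ix_j}{r^2}\Big),\qquad r=|x|.$$ Let $\alpha\in(0,\frac{\pi}{2})$. Then the map $$\tilde u\colon B^m\to\mathbb{S}^{m^2}\subset\mathbb{R}^{m^2}\times\mathbb{R},\qquad x\mapsto\big(\sin\alpha\;u(x),\cos\alpha\big)$$ is a proper weak biharmonic map if and only if $$\sin^2\alpha=1-\frac{2}{m}.$$
   Context: Maps are defined almost everywhere (here, for $x\neq0$); $\delta_{ij}$ is the Kronecker delta, $r=\sqrt{x_1^2+\dots+x_m^2}$, and $\Delta$ is the Euclidean Laplacian ($\Delta=\sum_k\partial_k^2$), acting componentwise. $W^{2,2}(B^m,\mathbb{S}^n)$ is the set of $w\in W^{2,2}(B^m,\mathbb{R}^{n+1})$ with $w(x)\in\mathbb{S}^n$ for a.e. $x$, where $\mathbb{S}^n\subset\mathbb{R}^{n+1}$ is the unit sphere. A map $w\in W^{2,2}(B^m,\mathbb{S}^n)$ is a weak biharmonic map if it solves $$\Delta^2w+2\operatorname{div}(|\nabla w|^2\nabla w)+\big(|\Delta w|^2+\Delta|\nabla w|^2+2\langle\nabla w,\nabla\Delta w\rangle+2|\nabla w|^4\big)w=0$$ in the sense of distributions on $B^m$, i.e. for every $\varphi\in C_c^\infty(B^m,\mathbb{R}^{n+1})$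 $$\int_{B^m}\Big(\langle\Delta w,\Delta\varphi\rangle-2|\nabla w|^2\langle\nabla w,\nabla\varphi\rangle+(|\Delta w|^2+2|\nabla w|^4)\langle w,\varphi\rangle+|\nabla w|^2\Delta\langle w,\varphi\rangle-2|\Delta w|^2\langle w,\varphi\rangle-2\sum_k\langle\Delta w,\partial_kw\rangle\,\partial_k\langle w,\varphi\rangle\Big)dx=0.$$ Here $|\nabla w|^2=\sum_k|\partial_kw|^2$. The equation is the Euler–Lagrange equation of the bienergy $E_2(w)=\frac12\int_{B^m}(|\Delta w|^2-|\nabla w|^4)\,dx$. A weak biharmonic map is proper if it is not (weakly) harmonic, i.e. if it does not solve $\Delta w+|\nabla w|^2w=0$ in the sense of distributions. *)

(* Defs.v *)
From HB Require Import structures.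
From mathcomp Require Import all_boot all_order all_algebra.
From mathcomp Require Import all_classical all_reals all_analysis.

Set Implicit Arguments.
Unset Strict Implicit.
Unset Printing Implicit Defensive.
Import Order.TTheory GRing.Theory Num.Theory.
Import numFieldNormedType.Exports.
Local Open Scope classical_set_scope.
Local Open Scope ring_scope.

(* The sigma-algebra on row vectors is generated by the coordinates, as for
   [n.-tuple T]; on ['rV[R]_n] it is the Borel sigma-algebra. *)
Definition rV_display : measure_display -> measure_display.
Proof. exact. Qed.

Section measurable_rV.
Context {d} {T : measurableType d}.
Variable n : nat.

Let coord : 'I_n -> 'rV[T]_n -> T := fun i x => x 0 i.

Let rV_set0 : g_sigma_preimage coord set0.
Proof. exact: sigma_algebra0. Qed.

Let rV_setC A : g_sigma_preimage coord A -> g_sigma_preimage coord (~` A).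
Proof. exact: sigma_algebraC. Qed.

Let rV_bigcup (F : _^nat) : (forall i, g_sigma_preimage coord (F i)) ->
  g_sigma_preimage coord (\bigcup_i (F i)).
Proof. exact: sigma_algebra_bigcup. Qed.

HB.instance Definition _ := @isMeasurable.Build (rV_display d)
  'rV[T]_n (g_sigma_preimage coord) rV_set0 rV_setC rV_bigcup.

End measurable_rV.

Section cons_rV.
Context {T : Type}.

Definition cons_rV n (p : T * 'rV[T]_n) : 'rV[T]_n.+1 :=
  \row_i (if unlift ord0 i is Some j then p.2 0 j else p.1).

Definition uncons_rV n (x : 'rV[T]_n.+1) : T * 'rV[T]_n :=
  (x 0 ord0, \row_j x 0 (lift ord0 j)).

Lemma uncons_rVK n : cancel (@uncons_rV n) (@cons_rV n).
Proof.
move=> x; apply/rowP => i; rewrite mxE.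
by case: unliftP => [j ->|->] //=; rewrite mxE.
Qed.

Lemma cons_rVK n : cancel (@cons_rV n) (@uncons_rV n).
Proof.
move=> [a x]; rewrite /uncons_rV mxE unlift_none/=; congr pair.
by apply/rowP => j; rewrite !mxE liftK.
Qed.

End cons_rV.

Section measurable_cons_rV.
Context {d} {T : measurableType d}.

Lemma measurable_coord n (i : 'I_n) :
  measurable_fun [set: 'rV[T]_n] (fun x : 'rV[T]_n => x 0 i).
Proof.
move=> _ Y mY; rewrite setTI; apply: sub_sigma_algebra => /=.
rewrite -bigcup_seq/=; exists i => /=; first by rewrite mem_index_enum.
by exists Y => //; rewrite setTI.
Qed.

Lemma measurable_fun_rVP d' (T' : measurableType d') n (f : T' -> 'rV[T]_n) :
  measurable_fun [set: T'] f <->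
  forall i, measurable_fun [set: T'] (fun x => f x 0 i).
Proof.
split=> [mf i|mf].
  by apply: (measurableT_comp (measurable_coord i)).
suff : g_sigma_preimage (fun i x => (f x : 'rV[T]_n) 0 i) `<=` measurable.
  rewrite (g_sigma_preimage_comp (fun i (x : 'rV[T]_n) => x 0 i) f) => prefS.
  by move=> _ A mA; apply: prefS; exists A.
apply: smallest_sub; first exact: sigma_algebra_measurable.
rewrite -bigcup_seq/=; apply: bigcup_sub => i _.
by move=> A [B mB <-]; exact: mf.
Qed.

Lemma measurable_cons_rV n : measurable_fun [set: T * 'rV[T]_n] (@cons_rV T n).
Proof.
apply/measurable_fun_rVP => i.
under eq_fun do rewrite mxE.
case: unlift => [j|] /=; last exact: measurable_fst.
exact: (measurableT_comp (measurable_coord j) measurable_snd).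
Qed.

Lemma measurable_uncons_rV n :
  measurable_fun [set: 'rV[T]_n.+1] (@uncons_rV T n).
Proof.
apply: measurable_fun_pair; first exact: measurable_coord.
by apply/measurable_fun_rVP => j; under eq_fun do rewrite mxE;
  exact: measurable_coord.
Qed.

End measurable_cons_rV.

Section lebesgue_measure_cons.
Local Open Scope ereal_scope.
Context {R : realType} (n : nat).
Variable mu : {sigma_finite_measure set 'rV[R]_n -> \bar R}.

Definition lebesgue_measure_cons : set 'rV[R]_n.+1 -> \bar R :=
  pushforward (@lebesgue_measure R \x mu) (@cons_rV R n).

Let mcons := @measurable_cons_rV _ R n.
Let m : {measure set (measurableTypeR R * 'rV[R]_n) -> \bar R} :=
  [the measure _ _ of (@lebesgue_measure R \x mu)].

Let cons_set0 : lebesgue_measure_cons set0 = 0.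
Proof. by rewrite /lebesgue_measure_cons /pushforward preimage_set0 measure0. Qed.

Let cons_ge0 A : 0 <= lebesgue_measure_cons A.
Proof. exact: (measure_ge0 m). Qed.

Let cons_sigma_additive : semi_sigma_additive lebesgue_measure_cons.
Proof.
move=> F mF tF mUF; rewrite /lebesgue_measure_cons /pushforward preimage_bigcup.
apply: (measure_semi_sigma_additive (s := m)).
- by move=> k; rewrite -[X in measurable X]setTI; exact: mcons.
- apply/trivIsetP => /= i j _ _ ij; rewrite -preimage_setI.
  by move/trivIsetP : tF => /(_ _ _ _ _ ij) ->//; rewrite preimage_set0.
- by rewrite -preimage_bigcup -[X in measurable X]setTI; exact: mcons.
Qed.

HB.instance Definition _ := isMeasure.Build _ _ _
  lebesgue_measure_cons cons_set0 cons_ge0 cons_sigma_additive.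

Let cons_sigma_finite : sigma_finite setT lebesgue_measure_cons.
Proof.
have /sigma_finiteP[F [TF ndF Foo]] := sigma_finiteT (@lebesgue_measure R).
have /sigma_finiteP[G [TG ndG Goo]] := sigma_finiteT mu.
exists (fun k => @uncons_rV R n @^-1` (F k `*` G k)).
  rewrite -preimage_bigcup (_ : \bigcup_k _ = setT) ?preimage_setT//.
  rewrite -subTset => -[x y] _.
  have [i _ Fx] : (\bigcup_k F k) x by rewrite -TF.
  have [j _ Gy] : (\bigcup_k G k) y by rewrite -TG.
  exists (maxn i j) => //; split.
  - by move: x Fx; exact/subsetPset/ndF/leq_maxl.
  - by move: y Gy; exact/subsetPset/ndG/leq_maxr.
move=> k; have [mF Fk] := Foo k; have [mG Gk] := Goo k; split.
  rewrite -[X in measurable X]setTI; apply: measurable_uncons_rV => //.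
  exact: measurableX.
rewrite /lebesgue_measure_cons /pushforward -comp_preimage.
rewrite (_ : _ \o _ = id) ?preimage_id; last first.
  by apply/funext => p; exact: cons_rVK.
by rewrite product_measure1E// lte_mul_pinfty// ge0_fin_numE.
Qed.

HB.instance Definition _ := Measure_isSigmaFinite.Build _ _ _
  lebesgue_measure_cons cons_sigma_finite.

End lebesgue_measure_cons.

Fixpoint lebesgue_rV {R : realType} n :
    {sigma_finite_measure set 'rV[R]_n -> \bar R} :=
  match n with
  | 0 => @dirac _ 'rV[R]_0 0 R
  | n'.+1 => lebesgue_measure_cons (lebesgue_rV n')
  end.

Lemma lebesgue_rV_box {R : realType} n (A : 'I_n -> set R) :
  (forall i, measurable (A i)) ->
  lebesgue_rV n [set x : 'rV[R]_n | forall i, A i (x 0 i)] =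
  (\prod_(i < n) lebesgue_measure (A i))%E.
Proof.
elim: n A => [|n IH] A mA.
  rewrite big_ord0 /= diracE (_ : _ \in _ = true)//.
  by apply/mem_set => - [i ilt]; have := ilt; rewrite ltn0.
rewrite big_ord_recl -IH//= /lebesgue_measure_cons /pushforward.
have mB : measurable [set x : 'rV[R]_n | forall i, A (lift ord0 i) (x 0 i)].
  rewrite [X in measurable X](_ : _ = \bigcap_(i in [set: 'I_n])
      ((fun x : 'rV[R]_n => x 0 i) @^-1` A (lift ord0 i))).
    by apply: fin_bigcap_measurable => // i _;
      rewrite -[X in measurable X]setTI; exact: measurable_coord.
  by apply/seteqP; split => x /= H i; [move=> _; exact: H|exact: H].
rewrite -product_measure1E//.
congr (_ _); apply/seteqP; split => -[a x] /= H.
- split=> [|i]; first by have := H ord0; rewrite mxE unlift_none.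
  by have := H (lift ord0 i); rewrite mxE liftK.
- by move: H => -[Ha Hx] i; rewrite mxE; case: unliftP => [j|] ->.
exact: (mA ord0).
Qed.

Section weak_biharmonic_maps.
Context {R : realType}.

(* ['rV[R]_n] carries the sup norm in the library, hence the Euclidean
   product and norm below; the topology is the same. *)
Definition dot n (u v : 'rV[R]_n) : R := \sum_i u 0 i * v 0 i.
Definition enorm n (u : 'rV[R]_n) : R := Num.sqrt (dot u u).
Definition unit_ball n : set 'rV[R]_n := [set x | enorm x < 1].
Definition unit_sphere n : set 'rV[R]_n := [set y | enorm y = 1].

Section domain.
Context {m : nat}.
Local Notation mu := (@lebesgue_rV R m).
Implicit Types (D K : set 'rV[R]_m) (k l : 'I_m) (f g : 'rV[R]_m -> R).

Section classical_derivatives.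
Context {V : normedModType R}.
Implicit Types phi : 'rV[R]_m -> V.

Definition partial k phi : 'rV[R]_m -> V := fun x => 'D_(delta_mx 0 k) phi x.

Definition laplacian phi : 'rV[R]_m -> V :=
  fun x => \sum_k partial k (partial k phi) x.

(* All iterated partial derivatives exist and are (Frechet) differentiable,
   in particular continuous. *)
Definition smooth phi : Prop :=
  forall (s : seq 'I_m) x, differentiable (foldr partial phi s) x.

Definition test_function D phi : Prop :=
  smooth phi /\
  exists K, [/\ compact K, K `<=` D & forall x, ~ K x -> phi x = 0].

End classical_derivatives.

Definition locally_integrable_rV D f : Prop :=
  measurable_fun D f /\
  forall K, compact K -> K `<=` D -> (\int[mu]_(x in K) `|f x|%:E < +oo)%E.

Definition is_weak_partial D k f g : Prop :=
  [/\ locally_integrable_rV D f, locally_integrable_rV D g &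
    forall phi : 'rV[R]_m -> R, test_function D phi ->
      \int[mu]_(x in D) (f x * partial k phi x) =
      - \int[mu]_(x in D) (g x * phi x)].

(* A representative, unique up to a null set; 0 if there is none. *)
Definition weak_partial D k f : 'rV[R]_m -> R :=
  xget (cst 0) [set g | is_weak_partial D k f g].

Definition weakly_differentiable D k f : Prop :=
  exists g, is_weak_partial D k f g.

Definition weak_laplacian D f : 'rV[R]_m -> R :=
  fun x => \sum_k weak_partial D k (weak_partial D k f) x.

Definition square_integrable D f : Prop :=
  measurable_fun D f /\ (\int[mu]_(x in D) (f x ^+ 2)%:E < +oo)%E.

Definition W22 D f : Prop :=
  [/\ square_integrable D f,
      forall k, weakly_differentiable D k f /\
        square_integrable D (weak_partial D k f) &
      forall k l, weakly_differentiable D l (weak_partial D k f) /\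
        square_integrable D (weak_partial D l (weak_partial D k f))].

Section sphere_valued.
Context {N : nat}.
Implicit Types w phi : 'rV[R]_m -> 'rV[R]_N.

Definition component w (i : 'I_N) : 'rV[R]_m -> R := fun x => w x 0 i.

Definition weak_partialv D k w : 'rV[R]_m -> 'rV[R]_N :=
  fun x => \row_i weak_partial D k (component w i) x.

Definition weak_laplacianv D w : 'rV[R]_m -> 'rV[R]_N :=
  fun x => \row_i weak_laplacian D (component w i) x.

Local Notation B := (@unit_ball m).

(* The target sphere is the one of dimension [N - 1]. *)
Definition W22_sphere w : Prop :=
  (forall i, W22 B (component w i)) /\
  {ae mu, forall x, B x -> unit_sphere (w x)}.

Definition energy_density w : 'rV[R]_m -> R :=
  fun x => \sum_k dot (weak_partialv B k w x) (weak_partialv B k w x).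

Definition weakly_harmonic w : Prop :=
  forall phi, test_function B phi ->
    \int[mu]_(x in B)
      (dot (w x) (laplacian phi x) + energy_density w x * dot (w x) (phi x))
    = 0.

Definition biharmonic_integrand w phi : 'rV[R]_m -> R := fun x =>
  let dw k := weak_partialv B k w x in
  let lap := weak_laplacianv B w x in
  let e := energy_density w x in
  let wphi := fun y => dot (w y) (phi y) in
  dot lap (laplacian phi x)
  - 2 * e * \sum_k dot (dw k) (partial k phi x)
  + (dot lap lap + 2 * e ^+ 2) * wphi x
  + e * weak_laplacian B wphi x
  - 2 * dot lap lap * wphi x
  - 2 * \sum_k dot lap (dw k) * weak_partial B k wphi x.

Definition weakly_biharmonic w : Prop :=
  W22_sphere w /\
  forall phi, test_function B phi ->
    \int[mu]_(x in B) biharmonic_integrand w phi x = 0.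

Definition proper_weakly_biharmonic w : Prop :=
  weakly_biharmonic w /\ ~ weakly_harmonic w.

End sphere_valued.
End domain.

(* [R^(m^2)] is the space of [m x m] matrices, flattened by [mxvec]. At the
   origin division by zero gives a junk value, on a null set. *)
Definition umap m (x : 'rV[R]_m) : 'rV[R]_(m * m) :=
  let r := enorm x in
  mxvec (\matrix_(i < m, j < m)
    ((Num.sqrt (m%:R * (m%:R - 1)))^-1 *
     (- (i == j)%:R + m%:R * (x 0 i * x 0 j / r ^+ 2)))).

Definition utilde m (alpha : R) (x : 'rV[R]_m) : 'rV[R]_(m * m + 1) :=
  row_mx (sin alpha *: umap x) (cos alpha)%:M.

End weak_biharmonic_maps.

(* Main.v *)
(* Off the origin [u] is homogeneous of degree 0 and satisfies
   [Delta u = - 2 m r^-2 u], hence [|nabla u|^2 = 2 m r^-2].  With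
   [s = sin^2 alpha], [v = (sin alpha u, 0)] and [w = utilde], the
   Euler-Lagrange expression of the bienergy, computed classically off the
   origin, is [8 m (m s - m + 2) r^-4 (s w - v)], and [Delta w + |nabla w|^2 w]
   is [2 m r^-2 (s w - v)].  The last component of [s w - v] is
   [s cos alpha <> 0], so testing with a bump function in the last coordinate
   shows that [w] is never harmonic, and is biharmonic iff [m s - m + 2 = 0].

   Since [m > 4], [r^-4] is integrable near the origin; by Fubini along lines
   missing the origin, a compactly supported function that is [C^1] off the
   origin with partial derivatives [O(r^-4)] has derivatives of integral zero.
   This yields all integrations by parts, in particular that classical
   derivatives are weak ones; by the du Bois-Reymond lemma the weak derivatives
   chosen in the definitions agree with them almost everywhere. *)

Require Import Defs.
From mathcomp Require Import all_boot all_order all_algebra.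
From mathcomp Require Import all_classical all_reals all_analysis.
From mathcomp Require Import measurable_realfun ring lra.
Import Order.TTheory GRing.Theory Num.Theory.
Import numFieldNormedType.Exports.
Set Implicit Arguments.
Unset Strict Implicit.
Unset Printing Implicit Defensive.
Local Open Scope classical_set_scope.
Local Open Scope ring_scope.

(** * Lebesgue measure on row vectors *)

(** The coefficients come out because of three relations for $v$ off the origin: Euler's identity
    $x\cdot\nabla v=0$, and the gradient and the Laplacian of $|v|^2=s$, which give $\langle
    v,\partial_k v\rangle=0$ and $|\nabla v|^2=2ms\,r^{-2}$. Hence the cross terms between $\nabla
    r^{-2}$ and $\nabla v$ vanish, and $\Delta w$ is orthogonal to every $\partial_k w$. Besides the
    term killed by this orthogonality, derivatives fall on $\varphi$ in three places of the
    integrand; each is removed by one divergence whose field is $O(r^{-3})$.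

    Nothing is smooth at the origin, not even $\langle w,\varphi\rangle$, and the values there are
    arbitrary. Regularity is therefore replaced by a syntactic class, [singular], from which
    measurability, growth and derivatives off the origin follow by induction, and by [jet], a
    calculus of gradients and Laplacians on $x\neq0$. Orders of singularity are then never estimated
    by hand, and identities are only compared off one point. *)

Section measure_theory_rV.
Context {R : realType}.

(** Balls of the sup norm are cubes, so an open set is the union of the countably many rational
    cubes that it contains. *)
Lemma open_measurable_rV {n} (U : set 'rV[R]_n) : open U -> measurable U.
Proof.
move=> oU.
pose box (p : 'rV[rat]_n * rat) : set 'rV[R]_n :=
  [set x | forall i, ball (ratr (p.1 0 i) : R) (ratr p.2) (x 0 i)].
have mbox p : measurable (box p).
  rewrite [X in measurable X](_ : _ = \bigcap_(i in [set: 'I_n])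
      ((fun x : 'rV[R]_n => x 0 i) @^-1` ball (ratr (p.1 0 i) : R) (ratr p.2))).
    apply: fin_bigcap_measurable => // i _.
    rewrite -[X in measurable X]setTI; apply: measurable_coord => //.
    by apply: open_measurable; exact: ball_open.
  by apply/seteqP; split => x /= H i; [move=> _; exact: H|exact: H].
rewrite (_ : U = \bigcup_(p in [set p | box p `<=` U]) box p).
  rewrite bigcup_mkcond.
  apply: countable_bigcupT_measurable; first exact: countableP.
  by move=> p; case: ifP.
apply/seteqP; split => [x Ux|x [p /= pU xp]]; last exact: pU.
have [e /= e0 xeU] := (@nbhs_ballP _ _ _ _).1 (open_nbhs_nbhs (conj oU Ux)).
have [q /andP[q0 qe]] : exists q : rat, 0 < (ratr q : R) < e / 2.
  have /rat_in_itvoo[q] : 0 < e / 2 by rewrite divr_gt0.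
  by rewrite in_itv/= => qe; exists q.
have H i : exists a : rat, ball (ratr a : R) (ratr q) (x 0 i).
  have /rat_in_itvoo[a] : x 0 i - ratr q < x 0 i + ratr q by lra.
  rewrite in_itv/= => /andP[a1 a2]; exists a.
  by rewrite /ball/= ltr_norml; apply/andP; split; lra.
have [a ha] := choice H.
exists (\row_i a i, q) => /=; last by move=> i /=; rewrite mxE.
move=> y /= hy; apply: xeU; split => // i j; rewrite ord1.
have := hy j; rewrite mxE/= => h1; have h2 := ha j.
apply: (@le_ball _ _ _ (ratr q + ratr q)); first by lra.
exact: ball_triangle (ball_sym h2) h1.
Qed.

Lemma closed_measurable_rV {n} (U : set 'rV[R]_n) : closed U -> measurable U.
Proof.
by move=> cU; rewrite -[U]setCK; apply: measurableC; apply: open_measurable_rV;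
  rewrite openC.
Qed.

Lemma continuous_measurable_rV {n} (f : 'rV[R]_n -> R) :
  continuous f -> measurable_fun setT f.
Proof.
move=> cf; apply: (measurability (@RGenOpens.G R)).
  exact: RGenOpens.measurableE.
move=> _ [_ [a [b ->]] <-]; rewrite setTI.
by apply: open_measurable_rV; apply: open_comp => // x _; exact: cf.
Qed.

Lemma lebesgue_rV_hyperplane {n} (i : 'I_n) :
  lebesgue_rV n [set x : 'rV[R]_n | x 0 i = 0] = 0%E.
Proof.
pose A j : set R := if j == i then [set 0] else setT.
rewrite (_ : [set _ | _] = [set x : 'rV[R]_n | forall j, A j (x 0 j)]).
  rewrite lebesgue_rV_box; last by move=> j; rewrite /A; case: ifP.
  by rewrite (bigD1 i)//= /A eqxx lebesgue_measure_set1 mul0e.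
apply/seteqP; split => [x /= xi j|x /= /(_ i)]; last by rewrite /A eqxx.
by rewrite /A; case: eqP => [->|].
Qed.

(** The origin lies in a coordinate hyperplane. In dimension 0 the measure is a Dirac mass at the
    origin, hence [0 < n]. *)
Lemma lebesgue_rV_neq0 {n} (P : 'rV[R]_n -> Prop) : (0 < n)%N ->
  (forall x, x != 0 -> P x) -> {ae lebesgue_rV n, forall x, P x}.
Proof.
case: n P => // n P _ HP.
exists [set x : 'rV[R]_n.+1 | x 0 ord0 = 0]; split.
- rewrite -[X in measurable X]setTI -/((fun x : 'rV[R]_n.+1 => x 0 ord0) @^-1` [set 0]).
  exact: measurable_coord.
- exact: lebesgue_rV_hyperplane.
- move=> x /= nPx; apply: contrapT => x0; apply: nPx; apply: HP.
  by apply/eqP => x00; apply: x0; rewrite x00 mxE.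
Qed.

Definition set_coord {n} (k : 'I_n) (x : 'rV[R]_n) (t : R) : 'rV[R]_n :=
  \row_i (if i == k then t else x 0 i).

Lemma lebesgue_rVS_integrable {n} (F : 'rV[R]_n.+1 -> \bar R) :
  (lebesgue_rV n.+1).-integrable setT F ->
  (@lebesgue_measure R \x lebesgue_rV n)%E.-integrable setT (F \o @cons_rV R n).
Proof.
move=> /integrableP[mF iF]; apply/integrableP; split.
  apply: (measurableT_comp mF); exact: measurable_cons_rV.
pose m : {measure set (measurableTypeR R * 'rV[R]_n) -> \bar R} :=
  [the measure _ _ of (@lebesgue_measure R \x lebesgue_rV n)%E].
have mc : measurable_fun [set: measurableTypeR R * 'rV[R]_n] (@cons_rV R n) :=
  @measurable_cons_rV _ (measurableTypeR R) n.
have mF' : measurable_fun setT (abse \o F) by exact: measurableT_comp.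
have := ge0_integral_pushforward mc m measurableT mF'.
by rewrite preimage_setT => <- // x _; exact: abse_ge0.
Qed.

Lemma integral_lebesgue_rVS {n} (F : 'rV[R]_n.+1 -> \bar R) :
  (lebesgue_rV n.+1).-integrable setT F ->
  (\int[lebesgue_rV n.+1]_x F x =
   \int[(@lebesgue_measure R \x lebesgue_rV n)%E]_p (F \o @cons_rV R n) p)%E.
Proof.
move=> iF; have := lebesgue_rVS_integrable iF.
rewrite /= => iF'.
pose m : {measure set (measurableTypeR R * 'rV[R]_n) -> \bar R} :=
  [the measure _ _ of (@lebesgue_measure R \x lebesgue_rV n)%E].
have mc : measurable_fun [set: measurableTypeR R * 'rV[R]_n] (@cons_rV R n) :=
  @measurable_cons_rV _ (measurableTypeR R) n.
have mF : measurable_fun setT F by move: iF => /integrableP[].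
have := integral_pushforward mc (mu := m) (D := setT) mF.
by rewrite preimage_setT; apply.
Qed.

(** Fubini for one chosen coordinate, although [lebesgue_rV] only splits off coordinate 0. If [k] is
    0, that coordinate is integrated first; otherwise almost every slice at fixed coordinate 0 is
    integrable and satisfies the same hypothesis in one dimension less. *)
Lemma integral_lines_eq0 {n} (k : 'I_n) (F : 'rV[R]_n -> \bar R) :
  (lebesgue_rV n).-integrable setT F ->
  (forall x, \int[@lebesgue_measure R]_t F (set_coord k x t) = 0)%E ->
  (\int[lebesgue_rV n]_x F x = 0)%E.
Proof.
elim: n k F => [[]//|n IH] k F iF Fl.
rewrite integral_lebesgue_rVS//; have iF' := lebesgue_rVS_integrable iF.
case: (unliftP ord0 k) => [j|] kE.
- rewrite -integral12_prod_meas1//.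
  transitivity (\int[@lebesgue_measure R]_x (cst 0%E) x)%E; last by rewrite integral0.
  apply: ae_eq_integral => //.
  + exact: (measurable_fubini_F iF').
  + have := ae_integrable1 iF'.
    apply: filterS => t it _ /=.
    apply: (IH j) => //= x.
    rewrite -[RHS](Fl (cons_rV (t, x))); apply: eq_integral => u _; congr F.
    apply/rowP => i; rewrite !mxE kE; case: unliftP => [i'|] ->/=.
      by rewrite (inj_eq lift_inj) mxE.
    by [].
- rewrite -integral21_prod_meas1//.
  rewrite /fubini_G; transitivity (\int[lebesgue_rV n]_x (cst (0 : \bar R)) x)%E;
    last by rewrite integral0.
  apply: eq_integral => y _ /=.
  rewrite -[RHS](Fl (cons_rV (0, y))); apply: eq_integral => u _; congr F.
  apply/rowP => i; rewrite !mxE kE; case: unliftP => [i'|] ->/=; last by [].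
  by [].
Qed.

End measure_theory_rV.

(** * Integrability of $|x|^{-4}$ and a vanishing criterion by quadrants *)

Section integrability_rV.
Context {R : realType} {n : nat}.
Local Notation mu := (@lebesgue_rV R n).

Lemma measurable_invr : measurable_fun setT (fun r : R => r^-1).
Proof.
rewrite -(setUv [set (0 : R)]); apply/measurable_funU => //; first exact: measurableC.
split; first exact: measurable_fun_set1.
apply: open_continuous_measurable_fun; first by rewrite openC; exact: closed_eq.
by move=> r; rewrite inE/= => r0; apply: inv_continuous; apply/eqP.
Qed.

Lemma closed_norm_ball : closed [set x : 'rV[R]_n | `|x| <= 1].
Proof.
rewrite (_ : [set _ | _] = (fun x : 'rV[R]_n => `|x|) @^-1` [set r : R | r <= 1])//.
by apply: preimage_closed; [move=> x _; exact: norm_continuous|exact: closed_le].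
Qed.

Lemma measurable_norm_expV d : measurable_fun setT (fun x : 'rV[R]_n => `|x| ^- d).
Proof.
apply: (measurableT_comp measurable_invr); apply: measurable_funX.
by apply: continuous_measurable_rV; exact: norm_continuous.
Qed.

Lemma le_coord_norm (x : 'rV[R]_n) i : `|x 0 i| <= `|x|.
Proof.
have /mapP[j Hj ->] : `|x 0 i| \in [seq `|x p.1 p.2| | p : 'I_1 * 'I_n].
  by apply/mapP; exists (ord0, i) => //=; rewrite mem_enum.
by rewrite [leRHS]/Num.norm /= mx_normrE; apply/bigmax_geP; right => /=; exists j.
Qed.

(** These sets are stable under intersection, generate the sigma-algebra, and have indicators that
    are limits of explicit smooth functions. *)
Definition quadrant (a : 'rV[R]_n) : set 'rV[R]_n := [set x | forall i, a 0 i < x 0 i].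

Lemma measurable_box_rV (A : 'I_n -> set R) : (forall i, measurable (A i)) ->
  measurable [set x : 'rV[R]_n | forall i, A i (x 0 i)].
Proof.
move=> mA; rewrite [X in measurable X](_ : _ = \bigcap_(i in [set: 'I_n])
    ((fun x : 'rV[R]_n => x 0 i) @^-1` A i)).
  by apply: fin_bigcap_measurable => // i _;
    rewrite -[X in measurable X]setTI; exact: measurable_coord.
by apply/seteqP; split => x /= H i; [move=> _; exact: H|exact: H].
Qed.

Lemma measurable_quadrant a : measurable (quadrant a).
Proof.
rewrite (_ : quadrant a = [set x : 'rV[R]_n | forall i, `]a 0 i, +oo[%classic (x 0 i)]).
  by apply: (@measurable_box_rV (fun i => `]a 0 i, +oo[%classic)) => i; exact: measurable_itv.
by apply/seteqP; split=> x /= H i; have := H i; rewrite in_itv/= andbT.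
Qed.

Lemma measurable_rV_quadrants :
  (@measurable _ 'rV[R]_n) `<=` <<s range quadrant >>.
Proof.
apply: smallest_sub; first exact: smallest_sigma_algebra.
rewrite -bigcup_seq/=; apply: bigcup_sub => i _ _ [A mA <-]; rewrite setTI.
pose T := g_sigma_algebraType (range quadrant).
suff mi : measurable_fun [set: T] (fun x : T => (x : 'rV[R]_n) 0 i).
  by have := mi measurableT A mA; rewrite setTI.
apply: (measurability (RGenOInfty.G (R:=R))); first exact: RGenOInfty.measurableE.
move=> _ [_ [a ->] <-]; rewrite setTI.
(* The half-space $x_i>a$ is exhausted by quadrants whose other bounds $-k$ tend to $-\infty$. *)
rewrite [X in measurable X](_ : _ =
  \bigcup_k quadrant (\row_j if j == i then a else - k%:R)).
  by apply: bigcupT_measurable => k;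
    apply: sub_sigma_algebra; exists (\row_j if j == i then a else - k%:R).
apply/seteqP; split => x /=.
  rewrite in_itv/= andbT => ax.
  exists (Num.bound `|x|) => // j; rewrite mxE; case: eqP => [->//|_].
  have : `|x 0 j| < (Num.bound `|x|)%:R.
    by rewrite (le_lt_trans (le_coord_norm _ _))// archi_boundP.
  by rewrite ltr_norml => /andP[].
by move=> [k _ /(_ i)]; rewrite mxE eqxx in_itv/= andbT.
Qed.

(** The sets over which [f] integrates to zero form a Dynkin system, the total integral being what
    handles the whole space and complements. By the pi-lambda theorem it contains every measurable
    set. *)
Lemma ae_eq0_quadrants (f : 'rV[R]_n -> R) :
  mu.-integrable setT (EFin \o f) ->
  (\int[mu]_x (f x)%:E = 0)%E ->
  (forall a, \int[mu]_(x in quadrant a) (f x)%:E = 0)%E ->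
  {ae mu, forall x, f x = 0}.
Proof.
move=> fi fT fq.
pose G A := measurable A /\ (\int[mu]_(x in A) (f x)%:E = 0)%E.
have mf : measurable_fun setT (EFin \o f) by move: fi => /integrableP[].
have dG : dynkin G.
  split; first by split.
  - move=> A [mA fA]; split; first exact: measurableC.
    rewrite -[LHS]add0e -[X in (X + _)%E]fA -integral_setU ?setUCr//.
    + exact: measurableC.
    + by apply/disj_setPS; rewrite setICr.
  - move=> F tF FG; split; first by apply: bigcupT_measurable => i; have [] := FG i.
    rewrite integral_bigcup//.
    + by apply: eseries0 => i _ _; have [] := FG i.
    + by move=> k; have [] := FG k.
    + by apply: integrableS fi => //; apply: bigcupT_measurable => i; have [] := FG i.
have sub : measurable `<=` G.
  apply: subset_trans (measurable_rV_quadrants) _.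
  rewrite -setI_closed_g_dynkin_g_sigma_algebra.
    by apply: smallest_sub => // _ [a _ <-]; split; [exact: measurable_quadrant|exact: fq].
  move=> _ _ [a _ <-] [b _ <-]; exists (\row_i Num.max (a 0 i) (b 0 i)) => //.
  apply/seteqP; split => x /=.
    by move=> H; split => i; have := H i; rewrite mxE gt_max => /andP[].
  by move=> [H1 H2] i; rewrite mxE gt_max H1 H2.
have : ae_eq mu setT (EFin \o f) (cst 0%E).
  apply: integral_ae_eq => // E _ mE.
  by rewrite integral0; have [] := sub _ mE.
by apply: filterS => x /(_ I) /= [].
Qed.

(* Dyadic cubes: on [2^-(j+1) < |x| <= 2^-j] the function is at most [16^(j+1)],
   and that cube has measure [2^n 2^(-jn)], with [n > 4]. *)
Lemma integral_norm4_lty : (4 < n)%N ->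
  (\int[mu]_(x in [set x : 'rV[R]_n | (`|x| <= 1)%R]) ((`|x| ^- 4)%R)%:E < +oo)%E.
Proof.
move=> n4.
pose Q j : set 'rV[R]_n := [set x | forall i, `[- (2 ^- j), 2 ^- j]%classic (x 0 i)].
have mQ j : measurable (Q j).
  by apply: (@measurable_box_rV
    (fun=> `[- (2 ^- j), 2 ^- j]%classic)) => i; exact: measurable_itv.
have mD : measurable [set x : 'rV[R]_n | `|x| <= 1].
  by apply: closed_measurable_rV; exact: closed_norm_ball.
pose u j (x : 'rV[R]_n) : \bar R := ((16 ^+ j.+1) * \1_(Q j) x)%:E.
have u0 j x : (0 <= u j x)%E by rewrite lee_fin mulr_ge0 ?exprn_ge0.
have mu_ j : measurable_fun setT (u j).
  by apply/measurable_EFinP; apply: measurable_funM => //; exact: measurable_indic.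
apply: (@le_lt_trans _ _ (\int[mu]_x (\sum_(j <oo) u j x))%E).
  rewrite integral_mkcond; apply: ge0_le_integral => //.
  - by move=> x _; rewrite /patch; case: ifP => // _; rewrite lee_fin invr_ge0.
  - apply/measurable_restrict => //; rewrite setTI; apply: measurable_funTS.
    by apply/measurable_EFinP; exact: measurable_norm_expV.
  - exact: ge0_emeasurable_sum.
  move=> x _; rewrite /patch; case: ifPn => [|_]; last by apply: nneseries_ge0.
  rewrite inE/= => x1.
  (* At the origin the integrand is 0, by the convention on the inverse of 0. *)
  have [->|x0] := eqVneq x 0.
    by rewrite normr0 expr0n/= invr0; apply: nneseries_ge0.
  have xp : 0 < `|x| by rewrite normr_gt0.
  (* The least exponent with $2^{-j}<|x|$ is positive because $|x|\le1$; its predecessor gives the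
     dyadic shell. *)
  have [j /andP[j1 j2]] : exists j, 2 ^- j.+1 < `|x| <= 2 ^- j.
    have ex : exists j, 2 ^- j < `|x|.
      exists (Num.bound (`|x|^-1)).
      rewrite invf_plt ?posrE ?exprn_gt0//.
      apply: lt_le_trans (archi_boundP _) _; first by rewrite invr_ge0.
      by rewrite -natrX ler_nat ltnW// ltn_expl.
    case: (ex_minnP ex) => -[|j] jx jmin; first by move: jx; rewrite expr0 invr1 ltNge x1.
    exists j; rewrite jx/= leNgt; apply/negP => /jmin; by rewrite ltnn.
  apply: (@le_trans _ _ (u j x)); last first.
    rewrite (nneseries_split 0 j.+1)//= big_mkord big_ord_recr/=.
    rewrite -[leLHS]add0e -[leLHS]adde0; apply: leeD; last by apply: nneseries_ge0.
    by apply: leeD => //; apply: sume_ge0.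
  rewrite lee_fin /u indicE mem_set ?mulr1; last first.
    move=> i /=; rewrite in_itv/= -ler_norml.
    exact: le_trans (le_coord_norm _ _) j2.
  rewrite invf_ple ?posrE ?exprn_gt0//.
  have -> : ((16 ^+ j.+1)^-1 : R) = (2 ^- j.+1) ^+ 4.
    by rewrite exprVn -exprM mulnC exprM; congr (_ ^+ _)^-1; rewrite -natrX.
  by rewrite lerXn2r ?nnegrE// ltW.
rewrite integral_nneseries//.
(* The $j$-th integral is $16^{j+1}2^n2^{-jn}\le16\cdot2^n\cdot2^{-j}$, written here in the shape of
   the summable geometric series. *)
apply: (@le_lt_trans _ _ (\sum_(j <oo) ((2 ^+ n.+4 * 2) / (2 ^ (j + 1))%:R)%:E)%E); last first.
  have /cvg_lim -> // := @cvg_geometric_eseries_half R (2 ^+ n.+4 * 2) 0.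
  by rewrite ltry.
apply: lee_nneseries => [j _ _|j _].
  exact: integral_ge0.
rewrite /u.
under eq_integral do rewrite EFinM.
rewrite ge0_integralZl//; last by apply/measurable_EFinP; exact: measurable_indic.
rewrite integral_indic// setIT.
rewrite [X in (_ * X)%E](_ :
  _ = \prod_(i < n) lebesgue_measure (`[- (2 ^- j), 2 ^- j]%classic : set R)%R)%E; last first.
  by apply: (@lebesgue_rV_box R n
    (fun=> `[- (2 ^- j), 2 ^- j]%classic)) => i; exact: measurable_itv.
rewrite (eq_bigr (fun=> ((2 ^- j) *+ 2)%:E)); last first.
  move=> i _; rewrite lebesgue_measure_itv/= lte_fin ifT.
    by rewrite -EFinD opprK mulr2n.
  by rewrite gtrN// invr_gt0 exprn_gt0.
rewrite prodEFin prodr_const card_ord -EFinM lee_fin.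
rewrite -[_ *+ 2]mulr_natr [(_ * 2) ^+ n]exprMn natrX addn1 [2 ^+ j.+1]exprS.
have -> : 2 ^+ n.+4 * 2 / (2 * 2 ^+ j) = 16 * 2 ^+ n * (2 ^- j) :> R.
  rewrite -(addn4 n) exprD; have : (2 ^+ j : R) != 0 by rewrite expf_neq0.
  by move=> h; field.
rewrite exprS -!mulrA ler_pM2l// mulrA [leRHS]mulrC ler_pM2r ?exprn_gt0//.
(* With $2^{-j}=16^j(2^{-j})^5$ the claim becomes monotonicity of powers of $2^{-j}\le1$, for
   exponents $5\le n$. *)
rewrite [leRHS](_ : _ = (16 ^+ j) * (2 ^- j) ^+ 5); last first.
  have h : (2 ^+ j : R) != 0 by rewrite expf_neq0.
  have -> : 16 ^+ j = (2 ^+ j) ^+ 4 :> R by rewrite -exprM mulnC exprM; congr (_ ^+ _);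
    rewrite -natrX.
  by field.
rewrite ler_pM2l ?exprn_gt0//; apply: ler_wiXn2l => //.
by rewrite invf_le1 ?exprn_gt0// exprn_ege1// ler1n.
Qed.

End integrability_rV.

(** * Smooth functions and bump functions *)

Section flat_exponential.
Context {R : realType}.
Implicit Types (t : R) (j : nat).

(** For $j=0$ this is the usual flat function $e^{-1/t}$. The powers $t^{-j}$ are included because
    they make the family closed under differentiation up to linear combinations. *)
Definition flat_exp j t : R := if 0 < t then t^-1 ^+ j * expR (- t^-1) else 0.

Lemma flat_exp_ge0 j t : 0 <= flat_exp j t.
Proof.
by rewrite /flat_exp; case: ifP => // t0; rewrite mulr_ge0 ?expR_ge0// exprn_ge0// invr_ge0 ltW.
Qed.

Lemma flat_exp_gt0 j t : 0 < t -> 0 < flat_exp j t.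
Proof. by move=> t0; rewrite /flat_exp t0 mulr_gt0 ?expR_gt0// exprn_gt0// invr_gt0. Qed.

Lemma flat_exp_npos j t : t <= 0 -> flat_exp j t = 0.
Proof. by move=> t0; rewrite /flat_exp ltNge t0. Qed.

Lemma flat_exp0_le1 t : flat_exp 0 t <= 1.
Proof.
rewrite /flat_exp; case: ifP => // t0; rewrite expr0 mul1r -expR0 ler_expR.
by rewrite oppr_le0 invr_ge0 ltW.
Qed.

(** From $e^y\ge y^{j+2}/(j+2)!$ at $y=1/t$. A quadratic bound is exactly what forces the derivative
    at 0 to exist and vanish. *)
Lemma flat_exp_le_sqr j t : flat_exp j t <= (j.+2)`!%:R * t ^+ 2.
Proof.
rewrite /flat_exp; case: ifPn => [t0|_]; last by rewrite mulr_ge0 ?sqr_ge0.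
have y0 : 0 < t^-1 by rewrite invr_gt0.
have := expR_ge1Dxn j.+1 (ltW y0).
set y := t^-1 in y0 *.
move=> h; rewrite expRN ler_pdivrMr ?expR_gt0//.
have f0 : 0 < (j.+2)`!%:R :> R by rewrite ltr0n fact_gt0.
rewrite -mulrA -ler_pdivrMl//.
apply: (@le_trans _ _ (t ^+ 2 * (y ^+ j.+2 / (j.+2)`!%:R))).
  rewrite mulrA ler_pdivlMr// mulrC mulrA mulfV ?gt_eqF// mul1r.
  rewrite -(add2n j) exprD mulrA -exprMn mulfV ?gt_eqF// expr1n mul1r//.
by rewrite ler_wpM2l ?sqr_ge0//; apply: le_trans h; rewrite lerDr.
Qed.

Lemma is_derive0_quadratic (f : R -> R) (C : R) :
  (forall t, `|f t| <= C * t ^+ 2) -> is_derive (0 : R) 1 f 0.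
Proof.
move=> fC.
have f0 : f 0 = 0.
  by apply/eqP; rewrite -normr_le0 (le_trans (fC 0))// expr0n/= mulr0.
have C0 : 0 <= C by have := fC 1; rewrite expr1n mulr1; exact: le_trans (normr_ge0 _).
(* [C] may be 0, and the neighbourhood of 0 is chosen by dividing by the constant. *)
have C1 : 0 < C + 1 by rewrite ltr_wpDl.
have cv : (fun h => h^-1 *: ((f \o shift 0) (h *: (1 : R)) - f 0)) @ 0^' --> (0 : R).
  apply/cvgrPdist_le => e e0; near=> h.
  have h0 : h != 0 by near: h; exact: nbhs_dnbhs_neq.
  rewrite sub0r normrN /= f0 subr0 addr0.
  rewrite /GRing.scale/= mulr1 normrM normfV.
  rewrite ler_pdivrMl ?normr_gt0// (le_trans (fC h))//.
  have -> : h ^+ 2 = `|h| * `|h| by rewrite -expr2 real_normK ?num_real.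
  rewrite mulrA [leRHS]mulrC ler_pM2r ?normr_gt0//.
  rewrite (@le_trans _ _ ((C + 1) * `|h|))//; first by rewrite ler_wpM2r// lerDl.
  rewrite -ler_pdivlMl//.
  by near: h; apply: dnbhs0_le; rewrite mulr_gt0// invr_gt0.
apply: DeriveDef; first by apply/cvg_ex; exists 0.
by rewrite /derive; apply/cvg_lim.
Unshelve. all: by end_near.
Qed.

Lemma is_derive_flat_exp j t :
  is_derive t 1 (flat_exp j) (flat_exp j.+2 t - j%:R * flat_exp j.+1 t).
Proof.
have [t0|t0|<-] := ltgtP 0 t; last first.
- rewrite !flat_exp_npos// mulr0 subr0.
  apply: (@is_derive0_quadratic _ (j.+2)`!%:R) => u.
  by rewrite ger0_norm ?flat_exp_ge0// flat_exp_le_sqr.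
- rewrite !flat_exp_npos ?(ltW t0)// mulr0 subr0.
  apply: (@near_eq_is_derive _ _ _ (cst 0)) => //.
  near=> u; rewrite flat_exp_npos//; apply: ltW; near: u.
  exact: lt_nbhsl.
- have t00 : t != 0 by rewrite gt_eqF.
  apply: (@near_eq_is_derive _ _ _ (fun u : R => u^-1 ^+ j * expR (- u^-1))).
    near=> u; rewrite /flat_exp ifT//; near: u; exact: lt_nbhsr.
  have dV : is_derive t 1 (fun u : R => u^-1) (- t ^- 2).
    have := @is_deriveV R id t 1 1 t00 (is_derive_id _ _).
    by rewrite /GRing.scale/= mulr1.
  have dE : is_derive t 1 (fun u : R => expR (- u^-1)) (expR (- t^-1) * t ^- 2).
    have := @is_derive1_comp _ expR (fun u => - u^-1) t _ _ (is_derive_expR _) (is_deriveN dV).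
    by rewrite opprK.
  have dX : is_derive t 1 (fun u : R => u^-1 ^+ j) (- (j%:R * t^-1 ^+ j.+1)).
    case: j => [|j].
      by rewrite mul0r oppr0; exact: (@is_derive_cst _ _ _ (1 : R) t 1).
    rewrite (_ : (fun u => _) = (fun u : R => u^-1) ^+ j.+1); last by rewrite exprfctE.
    apply: (is_derive_eq (is_deriveX j.+1 dV)); rewrite /GRing.scale/=.
    by rewrite mulrN; congr (- _); rewrite -exprVn -mulrA -exprD addn2.
  apply: (is_derive_eq (is_deriveM dX dE)).
  rewrite /flat_exp t0 /GRing.scale/= -exprVn !exprS; ring.
Unshelve. all: by end_near.
Qed.

End flat_exponential.

(** * Calculus of partial derivatives *)

Section partial_derivatives.
Context {R : realType} {m : nat}.
Implicit Types (f g : 'rV[R]_m -> R) (x : 'rV[R]_m) (k i : 'I_m) (a b : 'I_m -> R).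

(** Pairing differentiability with the values lets the rules of calculus be composed as terms,
    without separate side conditions. *)
Definition has_partials f a x := differentiable f x /\ forall k, partial k f x = a k.

Lemma has_partials_ext f g a b x : (forall y, f y = g y) -> (forall k, a k = b k) ->
  has_partials f a x -> has_partials g b x.
Proof. by move=> /funext <- /funext <-. Qed.

Lemma has_partialsE f x : differentiable f x -> has_partials f (fun k => partial k f x) x.
Proof. by []. Qed.

Lemma differentiable_near f g x :
  (\near x, f x = g x) -> differentiable f x -> differentiable g x.
Proof.
move=> fg df; have gfx := nbhs_singleton fg.
have E : g \o shift x = cst (g x) + 'd f x +o_ (0 : 'rV[R]_m) id.
  apply/eqaddoP => e e0; move/eqaddoP: (diff_locally df) => /(_ e e0) H.
  have fg0 : \forall h \near (0 : 'rV[R]_m), f (h + x) = g (h + x).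
    by move: fg; rewrite (near_shift 0 x) subr0.
  apply: filterS2 H fg0 => h /= H fgh.
  change (`|g (h + x) - (g x + 'd f x h)| <= e * `|h|).
  by rewrite -fgh -gfx.
apply/diff_locallyP; rewrite (diff_unique (diff_continuous df) E); split=> //.
exact: diff_continuous.
Qed.

Lemma has_partials_near f g a x : (\near x, f x = g x) -> has_partials f a x -> has_partials g a x.
Proof.
move=> fg [df fa]; split; first exact: differentiable_near df.
by move=> k; rewrite -fa; apply/esym/near_eq_derive.
Qed.

Lemma has_partials_cst (c : R) x : has_partials (fun=> c) (fun=> 0) x.
Proof.
split; first exact: differentiable_cst.
by move=> k; rewrite /partial deriveE ?diff_cst//; exact: differentiable_cst.
Qed.

Lemma has_partials_coord i x : has_partials (fun y => y 0 i) (fun k => (k == i)%:R) x.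
Proof.
split; first exact: differentiable_coord.
move=> k; rewrite /partial; apply: cvg_lim => //.
apply: cvg_near_cst.
near=> h; have h0 : h != 0 by near: h; exact: nbhs_dnbhs_neq.
rewrite /= !mxE eqxx/= addrK eq_sym /GRing.scale/= mulrA mulVf ?mul1r//.
Unshelve. all: by end_near.
Qed.

Lemma has_partialsD f g a b x : has_partials f a x -> has_partials g b x ->
  has_partials (fun y => f y + g y) (fun k => a k + b k) x.
Proof.
move=> [df fa] [dg gb]; split; first exact: differentiableD.
by move=> k; rewrite -fa -gb /partial -deriveD//; exact: diff_derivable.
Qed.

Lemma has_partialsM f g a b x : has_partials f a x -> has_partials g b x ->
  has_partials (fun y => f y * g y) (fun k => a k * g x + f x * b k) x.
Proof.
move=> [df fa] [dg gb]; split; first exact: differentiableM.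
move=> k; rewrite -fa -gb /partial addrC [_ * g x]mulrC.
by apply: deriveM; exact: diff_derivable.
Qed.

Lemma has_partials_sum (I : Type) (r : seq I) (F : I -> 'rV[R]_m -> R) (A : I -> 'I_m -> R) x :
  (forall j, has_partials (F j) (A j) x) ->
  has_partials (fun y => \sum_(j <- r) F j y) (fun k => \sum_(j <- r) A j k) x.
Proof.
move=> FA; elim: r => [|j r IH].
  by apply: has_partials_ext (has_partials_cst 0 x) => *; rewrite big_nil.
by apply: has_partials_ext (has_partialsD (FA j) IH) => *; rewrite big_cons.
Qed.

Lemma has_partials_comp (h : R -> R) (dh : R) f a x : is_derive (f x) 1 h dh ->
  has_partials f a x -> has_partials (fun y => h (f y)) (fun k => dh * a k) x.
Proof.
move=> hh [df fa].
have dh' : differentiable h (f x) by apply/derivable1_diffP; case: hh.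
split; first exact: differentiable_comp.
move=> k; rewrite -fa /partial.
rewrite (_ : (fun y => h (f y)) = h \o f)// deriveE; last exact: differentiable_comp.
rewrite diff_comp//= deriveE//.
rewrite -[X in 'd h _ X]mulr1 -/(GRing.scale ('d f x (delta_mx 0 k)) (1 : R)) linearZ/=.
by rewrite -derive1E' // derive1E (@derive_val _ _ _ _ _ _ _ hh) mulrC.
Qed.

Lemma has_partialsV f a x : f x != 0 -> has_partials f a x ->
  has_partials (fun y => (f y)^-1) (fun k => - (f x)^-1 ^+ 2 * a k) x.
Proof.
move=> fx0; apply: has_partials_comp.
have := @is_deriveV R id (f x) 1 1 fx0 (is_derive_id _ _).
by rewrite /GRing.scale/= mulr1 exprVn.
Qed.

Lemma has_partials_line f a x k : has_partials f a x ->
  is_derive (x 0 k) 1 (fun t => f (set_coord k x t)) (a k).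
Proof.
move=> [df fa].
have E t : set_coord k x t = (t - x 0 k) *: delta_mx 0 k + x.
  apply/rowP => i; rewrite !mxE eqxx/= eq_sym.
  by case: eqP => [->|_]; rewrite ?mulr1 ?subrK// mulr0 add0r.
have dk : derivable f x (delta_mx 0 k) by exact: diff_derivable.
have cv : (fun h => h^-1 *: (((fun t => f (set_coord k x t)) \o shift (x 0 k)) (h *: (1 : R)) -
    f (set_coord k x (x 0 k)))) @ 0^' --> a k.
  rewrite -fa; move: dk => /cvg_ex[l hl].
  rewrite (_ : (fun h => _) = (fun h => h^-1 *: ((f \o shift x) (h *: delta_mx 0 k) - f x))).
    by rewrite /partial /derive (cvg_lim _ hl)//.
  apply/funext => h /=; rewrite !E subrr scale0r add0r addrK.
  by rewrite /GRing.scale/= mulr1.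
apply: DeriveDef; first by apply/cvg_ex; exists (a k).
by rewrite /derive; apply/cvg_lim.
Qed.

End partial_derivatives.

(** * Smooth functions, Euclidean balls and bump functions *)

Section smooth_functions.
Context {R : realType} {m : nat}.
Implicit Types (f g : 'rV[R]_m -> R) (x : 'rV[R]_m) (k i : 'I_m).

(** [foldr] applies the derivative of the last index first, so lists are split from the right. *)
Lemma smoothP f : smooth f <->
  (forall x, differentiable f x) /\ forall k, smooth (partial k f).
Proof.
split=> [sf|[df sf] s x].
  split=> [x|k s x]; first exact: (sf [::]).
  by have := sf (rcons s k) x; rewrite foldr_rcons.
case/lastP: s => [|s k]; first exact: df.
by rewrite foldr_rcons; exact: sf.
Qed.

Lemma smooth_differentiable f x : smooth f -> differentiable f x.
Proof. by move=> /smoothP[]. Qed.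

Lemma smooth_partial f k : smooth f -> smooth (partial k f).
Proof. by move=> /smoothP[]. Qed.

(** A coinduction principle: it suffices to exhibit a class stable under a single partial
    derivative, so no iterated Leibniz or chain formula is ever written. *)
Lemma smooth_coind (P : ('rV[R]_m -> R) -> Prop) :
  (forall f, P f -> (forall x, differentiable f x) /\ forall k, P (partial k f)) ->
  forall f, P f -> smooth f.
Proof.
move=> H f Pf s; elim/last_ind: s f Pf => [|s k IH] f Pf x /=.
  by have [] := H _ Pf.
by rewrite foldr_rcons; apply: IH; have [] := H _ Pf.
Qed.

Lemma partial_ext f (g : 'I_m -> 'rV[R]_m -> R) k :
  (forall x, has_partials f (fun k => g k x) x) -> partial k f = g k.
Proof. by move=> fg; apply/funext => x; have [_] := fg x. Qed.

Lemma smooth_cst (c : R) : smooth (fun _ : 'rV[R]_m => c).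
Proof.
apply: (@smooth_coind (fun f => exists c, f = fun=> c)); last by exists c.
move=> _ [d ->]; split=> [x|k]; first by have [] := has_partials_cst d x.
by exists 0; apply: (partial_ext (g := fun k _ => 0)) => x; exact: has_partials_cst.
Qed.

Lemma smooth_coord i : smooth (fun x : 'rV[R]_m => x 0 i).
Proof.
apply/smoothP; split=> [x|k]; first by have [] := has_partials_coord i x.
rewrite (partial_ext (g := fun k _ => (k == i)%:R)); first exact: smooth_cst.
by move=> x; exact: has_partials_coord.
Qed.

(** The class fed to [smooth_coind]. All [j] occur together because differentiating [flat_exp j]
    produces [j + 1] and [j + 2]. *)
Inductive smooth_algebra : ('rV[R]_m -> R) -> Prop :=
| smooth_algebra_smooth f of smooth f : smooth_algebra f
| smooth_algebra_flat j f of smooth_algebra f :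
    smooth_algebra (fun x => flat_exp j (f x))
| smooth_algebraD f g of smooth_algebra f & smooth_algebra g :
    smooth_algebra (fun x => f x + g x)
| smooth_algebraM f g of smooth_algebra f & smooth_algebra g :
    smooth_algebra (fun x => f x * g x).

Lemma smooth_algebraP f : smooth_algebra f -> smooth f.
Proof.
apply: smooth_coind => {}f.
suff H : smooth_algebra f -> exists g : 'I_m -> 'rV[R]_m -> R,
    (forall k, smooth_algebra (g k)) /\ forall x, has_partials f (fun k => g k x) x.
  move=> /H[g [sg fg]]; split=> [x|k]; first by have [] := fg x.
  by rewrite (partial_ext k fg).
elim=> {f} [f sf|j f sf [g [sg fg]]|f1 f2 _ [g1 [sg1 fg1]] _ [g2 [sg2 fg2]]
  |f1 f2 sf1 [g1 [sg1 fg1]] sf2 [g2 [sg2 fg2]]].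
- exists (fun k => partial k f); split=> [k|x].
    by apply: smooth_algebra_smooth; exact: smooth_partial.
  by apply: has_partialsE; exact: smooth_differentiable.
- exists (fun k x => (flat_exp j.+2 (f x) + (- j%:R) * flat_exp j.+1 (f x)) * g k x).
  split=> [k|x]; last first.
    apply: has_partials_comp (fg x).
    by rewrite mulNr; exact: is_derive_flat_exp.
  apply: smooth_algebraM => //; apply: smooth_algebraD; first exact: smooth_algebra_flat.
  apply: smooth_algebraM; last exact: smooth_algebra_flat.
  by apply: smooth_algebra_smooth; exact: smooth_cst.
- exists (fun k x => g1 k x + g2 k x); split=> [k|x]; first exact: smooth_algebraD.
  exact: has_partialsD.
- exists (fun k x => g1 k x * f2 x + f1 x * g2 k x); split=> [k|x].
    by apply: smooth_algebraD; exact: smooth_algebraM.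
  exact: has_partialsM.
Qed.

Lemma smoothD f g : smooth f -> smooth g -> smooth (fun x => f x + g x).
Proof.
by move=> sf sg; apply: smooth_algebraP; apply: smooth_algebraD; exact: smooth_algebra_smooth.
Qed.

Lemma smoothM f g : smooth f -> smooth g -> smooth (fun x => f x * g x).
Proof.
by move=> sf sg; apply: smooth_algebraP; apply: smooth_algebraM; exact: smooth_algebra_smooth.
Qed.

Lemma smooth_flat_exp j f : smooth f -> smooth (fun x => flat_exp j (f x)).
Proof.
by move=> sf; apply: smooth_algebraP; apply: smooth_algebra_flat; exact: smooth_algebra_smooth.
Qed.

Lemma smooth_sum (I : Type) (r : seq I) (F : I -> 'rV[R]_m -> R) :
  (forall j, smooth (F j)) -> smooth (fun x => \sum_(j <- r) F j x).
Proof.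
move=> sF; elim: r => [|j r IH].
  by under eq_fun do rewrite big_nil; exact: smooth_cst.
by under eq_fun do rewrite big_cons; exact: smoothD.
Qed.

Lemma smooth_prod (I : Type) (r : seq I) (F : I -> 'rV[R]_m -> R) :
  (forall j, smooth (F j)) -> smooth (fun x => \prod_(j <- r) F j x).
Proof.
move=> sF; elim: r => [|j r IH].
  by under eq_fun do rewrite big_nil; exact: smooth_cst.
by under eq_fun do rewrite big_cons; exact: smoothM.
Qed.

Lemma smooth_continuous f : smooth f -> continuous f.
Proof. by move=> sf x; apply: differentiable_continuous; exact: smooth_differentiable. Qed.

Lemma smooth_measurable f : smooth f -> measurable_fun setT f.
Proof. by move=> /smooth_continuous; exact: continuous_measurable_rV. Qed.

Lemma smooth_dot : smooth (fun x : 'rV[R]_m => dot x x).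
Proof. by apply: smooth_sum => i; apply: smoothM; exact: smooth_coord. Qed.

Lemma dot_ge0 (x : 'rV[R]_m) : 0 <= dot x x.
Proof. by apply: sumr_ge0 => i _; rewrite -expr2 sqr_ge0. Qed.

Lemma sqr_coord_le_dot (x : 'rV[R]_m) i : (x 0 i) ^+ 2 <= dot x x.
Proof.
rewrite /dot (bigD1 i)//= -expr2 lerDl; apply: sumr_ge0 => j _.
by rewrite -expr2 sqr_ge0.
Qed.

Lemma sqr_norm_le_dot (x : 'rV[R]_m) : `|x| ^+ 2 <= dot x x.
Proof.
rewrite -[leRHS]sqr_sqrtr ?dot_ge0// lerXn2r ?nnegrE ?sqrtr_ge0//.
rewrite [leLHS]/Num.norm/= mx_normrE; apply/bigmax_leP; split; first exact: sqrtr_ge0.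
move=> /= -[a i] _ /=; rewrite ord1 -sqrtr_sqr ler_wsqrtr//.
exact: sqr_coord_le_dot.
Qed.

Lemma dot_gt0 (x : 'rV[R]_m) : x != 0 -> 0 < dot x x.
Proof.
move=> x0; apply: lt_le_trans (sqr_norm_le_dot x).
by rewrite exprn_gt0// normr_gt0.
Qed.

Lemma unit_ballE (x : 'rV[R]_m) : unit_ball x <-> dot x x < 1.
Proof.
rewrite /unit_ball /enorm /=; split=> h.
  by rewrite -[ltLHS]sqr_sqrtr ?dot_ge0// expr_lt1// sqrtr_ge0.
by rewrite -sqrtr1 ltr_sqrt.
Qed.

Lemma unit_ball_norm (x : 'rV[R]_m) : unit_ball x -> `|x| <= 1.
Proof.
move=> /unit_ballE h.
by rewrite -(@expr_le1 _ 2)// (le_trans (sqr_norm_le_dot x))// ltW.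
Qed.

(** The parameter is the squared radius, so that the defining function is a polynomial. *)
Definition dot_ball (r : R) : set 'rV[R]_m := [set x | dot x x <= r].

Lemma compact_dot_ball r : compact (dot_ball r).
Proof.
apply: bounded_closed_compact; last first.
  rewrite (_ : dot_ball r = (fun x : 'rV[R]_m => dot x x) @^-1` [set s : R | s <= r])//.
  by apply: preimage_closed;
    [move=> x _; exact: (smooth_continuous smooth_dot)|exact: closed_le].
exists (r + 1); split; first exact: num_real.
move=> M rM x /= xr.
apply: (@le_trans _ _ (r + 1)); last exact: ltW.
have [x1|x1] := leP `|x| 1.
  by rewrite (le_trans x1)// lerDr (le_trans _ xr)// dot_ge0.
rewrite (@le_trans _ _ (`|x| ^+ 2))//; first by rewrite expr2 ler_peMr// ltW.
by rewrite (le_trans (sqr_norm_le_dot x))// (le_trans xr)// lerDl.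
Qed.

Lemma dot_ball_sub r : r < 1 -> dot_ball r `<=` @unit_ball R m.
Proof. by move=> r1 x xr; apply/unit_ballE; exact: le_lt_trans r1. Qed.

Lemma measurable_dot_lt r : measurable [set x : 'rV[R]_m | dot x x < r].
Proof.
rewrite (_ : [set _ | _] = (fun x : 'rV[R]_m => dot x x) @^-1` [set s : R | s < r])//.
apply: open_measurable_rV; apply: open_comp; last exact: open_lt.
by move=> x _; exact: (smooth_continuous smooth_dot).
Qed.

Lemma measurable_unit_ball : measurable (@unit_ball R m).
Proof.
rewrite (_ : @unit_ball R m = [set x : 'rV[R]_m | dot x x < 1]); first exact: measurable_dot_lt.
by apply/seteqP; split=> x /=; [move=> /unit_ballE|move=> h; apply/unit_ballE].
Qed.

Lemma partial_off_compact (K : set 'rV[R]_m) f k x :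
  compact K -> (forall y, ~ K y -> f y = 0) -> ~ K x -> partial k f x = 0.
Proof.
move=> cK f0 Kx; rewrite /partial (@near_eq_derive _ _ _ f (cst 0)) ?derive_cst//.
have : open (~` K) by rewrite openC; exact: compact_closed.
rewrite openE => /(_ x Kx); apply: filterS => z; exact: f0.
Qed.

Definition ball_bump (r : R) : 'rV[R]_m -> R := fun x => flat_exp 0 (r - dot x x).

Lemma smooth_ball_bump r : smooth (ball_bump r).
Proof.
apply: smooth_flat_exp; apply: smoothD; first exact: smooth_cst.
rewrite (_ : (fun x => _) = fun x : 'rV[R]_m => (- 1) * dot x x).
  by apply: smoothM; [exact: smooth_cst|exact: smooth_dot].
by apply/funext => x; rewrite mulN1r.
Qed.

Lemma ball_bump_out r x : ~ dot_ball r x -> ball_bump r x = 0.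
Proof.
move=> /negP; rewrite -ltNge => rx.
by rewrite /ball_bump flat_exp_npos// subr_le0 ltW.
Qed.

Lemma test_function_ball_bump r : r < 1 -> test_function (@unit_ball R m) (ball_bump r).
Proof.
move=> r1; split; first exact: smooth_ball_bump.
exists (dot_ball r); split; [exact: compact_dot_ball|exact: dot_ball_sub|].
by move=> x; exact: ball_bump_out.
Qed.

Lemma test_functionM D f g : smooth f -> test_function D g ->
  test_function D (fun x => f x * g x).
Proof.
move=> sf [sg [K [cK KD g0]]]; split; first exact: smoothM.
by exists K; split=> // x /g0 ->; rewrite mulr0.
Qed.

(** Since $e^{-1/(Nt)}\to1$ for $t>0$, this tends to the indicator of [quadrant a] as $N\to\infty$,
    with values in $[0,1]$ throughout. *)
Definition quadrant_bump (N : nat) (a x : 'rV[R]_m) : R :=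
  \prod_(i < m) flat_exp 0 (N%:R * (x 0 i - a 0 i)).

Lemma smooth_quadrant_bump N a : smooth (quadrant_bump N a).
Proof.
apply: smooth_prod => i; apply: smooth_flat_exp.
apply: smoothM; first exact: smooth_cst.
by apply: smoothD; [exact: smooth_coord|exact: smooth_cst].
Qed.

Lemma quadrant_bump_ge0 N a x : 0 <= quadrant_bump N a x.
Proof. by apply: prodr_ge0 => i _; exact: flat_exp_ge0. Qed.

Lemma quadrant_bump_le1 N a x : quadrant_bump N a x <= 1.
Proof.
rewrite -[leRHS](_ : \prod_(i < m) (1 : R) = 1); last by rewrite big1.
by apply: ler_prod => i _; rewrite flat_exp_ge0 flat_exp0_le1.
Qed.

Lemma cvg_flat_exp0 (t : R) :
  flat_exp 0 (N%:R * t) @[N --> \oo] --> ((0 < t)%R%:R : R).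
Proof.
have [t0|t0] := leP t 0.
  apply: cvg_near_cst; near=> N.
  by rewrite flat_exp_npos// mulr_ge0_le0.
apply: (@cvg_trans _ ((fun N : nat => expR (- (N%:R * t)^-1)) @ \oo)).
  apply: near_eq_cvg; near=> N.
  have N0 : (0 < N)%N by near: N; exact: nbhs_infty_gt.
  by rewrite /flat_exp mulr_gt0 ?ltr0n// expr0 mul1r.
have -> : true%:R = expR 0 :> R by rewrite expR0.
apply: continuous_cvg; first exact: continuous_expR.
rewrite -[X in _ --> X]oppr0; apply: cvgN.
rewrite (_ : (fun x : nat => _) = (fun N : nat => N%:R^-1 * t^-1)); last first.
  by apply/funext => N; rewrite invfM.
rewrite -[X in _ --> X](mul0r t^-1); apply: cvgMr_tmp.
by rewrite -(cvg_shiftS (fun N : nat => N%:R^-1 : R)); exact: cvg_harmonic.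
Unshelve. all: by end_near.
Qed.

Lemma cvg_quadrant_bump a x :
  quadrant_bump N a x @[N --> \oo] --> (\1_(quadrant a) x : R).
Proof.
rewrite (_ : \1_(quadrant a) x = \prod_(i < m) (0 < x 0 i - a 0 i)%R%:R :> R).
  rewrite /quadrant_bump; elim: (index_enum _) => [|i s IH].
    by rewrite big_nil; under eq_fun do rewrite big_nil; exact: cvg_cst.
  rewrite big_cons; under eq_fun do rewrite big_cons.
  by apply: cvgM IH; exact: cvg_flat_exp0.
rewrite indicE; have [ax|nax] := pselect (quadrant a x).
  by rewrite mem_set// big1// => i _; rewrite subr_gt0 ax.
rewrite memNset//; apply/esym/eqP; apply/prodf_eq0.
have /existsNP[i /negP ai] := nax.
by exists i => //; rewrite subr_gt0 (negPf ai).
Qed.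

End smooth_functions.

(** * The du Bois-Reymond lemma *)

Section du_bois_reymond.
Context {R : realType} {m : nat}.
Local Notation mu := (@lebesgue_rV R m).
Local Notation B := (@unit_ball R m).
Implicit Types (f g phi : 'rV[R]_m -> R).

Lemma locally_integrable_bump f r : r < 1 -> locally_integrable_rV B f ->
  mu.-integrable setT (EFin \o (f \* ball_bump r)).
Proof.
move=> r1 [mf fK].
have cK : compact (@dot_ball R m r) by exact: compact_dot_ball.
have mK : measurable (@dot_ball R m r).
  by apply: closed_measurable_rV; exact: compact_closed.
(* [f] is measurable on the ball only; writing the product as a restriction makes it measurable on
   the whole space. *)
have E : f \* ball_bump r = (f \* ball_bump r) \_ (dot_ball r).
  apply/funext => x; rewrite /patch; case: ifPn => // /negP xr /=.
  by rewrite ball_bump_out ?mulr0// => xr'; apply: xr; rewrite inE.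
have mfr : measurable_fun setT (f \* ball_bump r).
  rewrite E; apply/measurable_restrict => //; rewrite setTI.
  apply: measurable_funM; last by apply: measurable_funTS;
    apply: smooth_measurable; exact: smooth_ball_bump.
  by apply: measurable_funS mf => //; [exact: measurable_unit_ball|exact: dot_ball_sub].
apply/integrableP; split; first exact/measurable_EFinP.
apply: le_lt_trans (fK _ cK (dot_ball_sub r1)).
rewrite [leRHS]integral_mkcond; apply: ge0_le_integral => //.
- by apply/measurable_EFinP; apply: measurableT_comp.
- apply/measurable_restrict => //; rewrite setTI; apply/measurable_EFinP;
  apply: measurableT_comp => //.
  by apply: measurable_funS mf => //; [exact: measurable_unit_ball|exact: dot_ball_sub].
- move=> x _ /=; rewrite /patch; case: ifPn => [xr|/negP xr]; last first.
    by rewrite ball_bump_out ?mulr0 ?normr0// => xr'; apply: xr; rewrite inE.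
  rewrite lee_fin normrM ler_piMr//.
  by rewrite ger0_norm ?flat_exp_ge0// flat_exp0_le1.
Qed.

(* Testing against [ball_bump r * quadrant_bump N a] and letting [N] tend to
   infinity, the integral of [f * ball_bump r] over each quadrant vanishes. *)
Lemma du_bois_reymond f : locally_integrable_rV B f ->
  (forall phi, test_function B phi -> \int[mu]_(x in B) (f x * phi x) = 0) ->
  {ae mu, forall x, B x -> f x = 0}.
Proof.
move=> lf f0.
have H r : r < 1 -> {ae mu, forall x, f x * ball_bump r x = 0}.
  move=> r1; have fi := locally_integrable_bump r1 lf.
  have mfi : measurable_fun setT (f \* ball_bump r).
    by apply/measurable_EFinP; move: fi => /integrableP[].
  (* The factor [phi] needs no compact support, since [ball_bump r] supplies it. This applies to the
     constant 1 and to the quadrant bumps. *)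
  have B0 phi : smooth phi -> (forall x, `|phi x| <= 1) ->
      (\int[mu]_x (f x * ball_bump r x * phi x)%:E = 0)%E.
    move=> sphi phi1.
    have := f0 _ (test_functionM sphi (test_function_ball_bump r1)).
    rewrite Rintegral_mkcond /Rintegral.
    rewrite (_ : (fun x => _) = fun x => (f x * ball_bump r x * phi x)%:E); last first.
      apply/funext => x; congr EFin; rewrite /patch; case: ifPn => [_|/negP xB].
        by rewrite [phi x * _]mulrC mulrA.
      rewrite ball_bump_out ?mulr0 ?mul0r// => xr; apply: xB; rewrite inE.
      exact: (dot_ball_sub r1).
    (* The real integral is [fine] of the extended one, so its vanishing transfers only once the
       latter is known to be finite. *)
    move=> h; rewrite -[LHS]fineK ?h//.
    apply: integrable_fin_num => //.
    apply: (le_integrable _ _ _ fi) => //.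
      apply/measurable_EFinP; apply: measurable_funM => //; exact: smooth_measurable.
    by move=> x _ /=; rewrite lee_fin normrM ler_piMr.
  apply: (@ae_eq0_quadrants R m (f \* ball_bump r)) => //.
    rewrite -[RHS](B0 (fun=> 1))//; last 2 first.
      exact: smooth_cst.
      by move=> x; rewrite normr1.
    by apply: eq_integral => x _ /=; rewrite mulr1.
  move=> a.
  have mq := @measurable_quadrant R m a.
  have := @dominated_convergence _ _ R mu setT measurableT
    (fun N x => (f x * ball_bump r x * quadrant_bump N a x)%:E)
    (fun x => (f x * ball_bump r x * \1_(quadrant a) x)%:E)
    (abse \o (EFin \o (f \* ball_bump r))).
  case.
  - move=> N; apply/measurable_EFinP; apply: measurable_funM => //.
    by apply: smooth_measurable; exact: smooth_quadrant_bump.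
  - apply/measurable_EFinP; apply: measurable_funM => //; exact: measurable_indic.
  - apply: aeW => x _; apply: cvg_EFin; first exact: nearW.
    by apply: cvgM; [exact: cvg_cst|exact: cvg_quadrant_bump].
  - exact: integrable_abse.
  - apply: aeW => x N _ /=; rewrite lee_fin normrM ler_piMr//.
    by rewrite ger0_norm ?quadrant_bump_ge0// quadrant_bump_le1.
  move=> _ _.
  rewrite (_ : [sequence _]_N = fun=> 0%E); last first.
    apply/funext => N /=; apply: B0; first exact: smooth_quadrant_bump.
    by move=> x; rewrite ger0_norm ?quadrant_bump_ge0// quadrant_bump_le1.
  move=> /(cvg_lim (@ereal_hausdorff R)); rewrite lim_cst; last exact: ereal_hausdorff.
  move=> ->; rewrite [LHS]integral_mkcond; apply: eq_integral => x _ /=.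
  by rewrite /patch indicE; case: ifP => _; rewrite ?mulr1 ?mulr0.
(* Countably many squared radii below 1 suffice: each point of the open ball lies where one of these
   bumps is positive. *)
have : {ae mu, forall x, forall n : nat, f x * ball_bump (1 - n.+1%:R^-1) x = 0}.
  apply: ae_foralln => n; apply: H.
  by rewrite ltrBlDr ltrDl invr_gt0.
apply: filterS => x fx /unit_ballE x1.
have [n nx] : exists n : nat, n.+1%:R^-1 < 1 - dot x x.
  have p : 0 < 1 - dot x x by rewrite subr_gt0.
  have := near_infty_natSinv_lt (PosNum p) => -[n _ /(_ n)/(_ (leqnn _))] /=.
  by exists n.
have /eqP := fx n; rewrite mulf_eq0 => /orP[/eqP//|].
rewrite gt_eqF// /ball_bump flat_exp_gt0//.
by move: nx; set u := _^-1; set v := dot x x; lra.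
Qed.

End du_bois_reymond.

(** * Functions singular at the origin *)

Section singular_functions.
Context {R : realType} {m : nat}.
Local Notation mu := (@lebesgue_rV R m).
Local Notation B := (@unit_ball R m).
Implicit Types (f g phi : 'rV[R]_m -> R) (x : 'rV[R]_m) (i j k : 'I_m) (d e : nat).

Lemma closed_set0_rV : closed [set (0 : 'rV[R]_m)].
Proof.
rewrite (_ : [set _] = (fun x : 'rV[R]_m => `|x|) @^-1` [set 0]).
  by apply: preimage_closed; [move=> x _; exact: norm_continuous|exact: closed_eq].
by apply/seteqP; split=> x /=; [move=> ->; exact: normr0|move/eqP; rewrite normr_eq0 => /eqP].
Qed.

(** This is $r^{-2}$ off the origin, and 0 at the origin. *)
Definition isq (x : 'rV[R]_m) : R := (dot x x)^-1.

(* Each generator and each of its partial derivatives lies in the class, one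
   derivative raising the order [d] of the singularity [O(r^-d)] by one. *)
Inductive singular : nat -> ('rV[R]_m -> R) -> Prop :=
| singular_smooth f of smooth f : singular 0 f
| singular_angular i j : singular 0 (fun x => x 0 i * x 0 j * isq x)
| singular_radial i : singular 1 (fun x => x 0 i * isq x)
| singularD d f g of singular d f & singular d g :
    singular d (fun x => f x + g x)
| singularM d e f g of singular d f & singular e g :
    singular (d + e) (fun x => f x * g x)
| singular_weaken d f of singular d f : singular d.+1 f
| singular_eq d f g of singular d f & (forall x, x != 0 -> f x = g x) : singular d g.

Lemma singular_le d e f : (d <= e)%N -> singular d f -> singular e f.
Proof.
move=> de sf; rewrite -(subnK de); elim: (e - d)%N => // n IH.
exact: singular_weaken.
Qed.

Lemma singular_cst (c : R) : singular 0 (fun=> c).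
Proof. exact/singular_smooth/smooth_cst. Qed.

Lemma singularZ d f (c : R) : singular d f -> singular d (fun x => c * f x).
Proof. by move=> sf; apply: (singularM (singular_cst c) sf). Qed.

Lemma singular_sum (I : Type) (r : seq I) d (F : I -> 'rV[R]_m -> R) :
  (forall l, singular d (F l)) -> singular d (fun x => \sum_(l <- r) F l x).
Proof.
move=> sF; elim: r => [|l r IH].
  by under eq_fun do rewrite big_nil; apply: (singular_le _ (singular_cst 0)).
by under eq_fun do rewrite big_cons; exact: singularD.
Qed.

(** $r^{-2}=\sum_i(x_ir^{-2})^2$, a sum of squares of radial generators. *)
Lemma singular_isq : singular 2 isq.
Proof.
rewrite (_ : isq = fun x => \sum_i (x 0 i * isq x) * (x 0 i * isq x)).
  by apply: singular_sum => i; apply: (singularM (singular_radial i) (singular_radial i)).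
apply/funext => x.
transitivity (dot x x * isq x ^+ 2).
  have [x0|x0] := eqVneq (dot x x) 0; first by rewrite /isq x0 invr0 mul0r.
  by rewrite /isq expr2 mulrA mulfV// mul1r.
by rewrite /dot mulr_suml; apply: eq_bigr => i _; rewrite expr2; ring.
Qed.

Lemma singular_measurable d f : singular d f -> measurable_fun setT f.
Proof.
have misq : measurable_fun setT isq.
  by apply: (measurableT_comp measurable_invr); apply: smooth_measurable; exact: smooth_dot.
elim=> {d f} [f|i j|i|d f g _ mf _ mg|d e f g _ mf _ mg|//|d f g _ mf fg].
- exact: smooth_measurable.
- by apply: measurable_funM => //; apply: measurable_funM; exact: measurable_coord.
- by apply: measurable_funM => //; exact: measurable_coord.
- exact: measurable_funD.
- exact: measurable_funM.
(* The two functions differ at the origin only, and the difference there is a multiple of an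
   indicator. *)
- rewrite (_ : g = fun x => f x + (g 0 - f 0) * \1_[set (0 : 'rV[R]_m)] x).
    apply: measurable_funD => //; apply: measurable_funM => //; apply: measurable_indic.
    by apply: closed_measurable_rV; exact: closed_set0_rV.
  apply/funext => x; rewrite indicE; have [->|x0] := eqVneq x 0.
    by rewrite mem_set// mulr1 addrC subrK.
  by rewrite memNset ?mulr0 ?addr0 ?fg// => xE; rewrite xE eqxx in x0.
Qed.

Lemma near_neq0 x : x != 0 -> \near x, x != 0.
Proof.
move=> x0; have : open (~` [set (0 : 'rV[R]_m)]).
  by rewrite openC; exact: closed_set0_rV.
rewrite openE => /(_ x) oK; have : (~` [set (0 : 'rV[R]_m)])^° x.
  by apply: oK => xE; rewrite xE eqxx in x0.
by apply: filterS => z z0; apply/eqP.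
Qed.

Lemma has_partials_isq x : x != 0 ->
  has_partials isq (fun k => - 2 * (x 0 k * isq x) * isq x) x.
Proof.
move=> x0; have d0 : dot x x != 0 by rewrite gt_eqF// dot_gt0.
have H : has_partials (fun y => dot y y) (fun k => 2 * x 0 k) x.
  apply: has_partials_ext (has_partials_sum (index_enum _)
    (fun i => has_partialsM (has_partials_coord i x) (has_partials_coord i x))) => // k.
  rewrite (bigD1 k)//= eqxx big1 ?addr0; first by rewrite /= mul1r mulr1; ring.
  by move=> i ik; rewrite eq_sym (negPf ik) /= mul0r mulr0 addr0.
apply: has_partials_ext (has_partialsV (f := fun y => dot y y) d0 H) => // k.
by rewrite -/(isq x); ring.
Qed.

Lemma singular_partials d f : singular d f -> exists g : 'I_m -> 'rV[R]_m -> R,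
  (forall k, singular d.+1 (g k)) /\
  forall x, x != 0 -> has_partials f (fun k => g k x) x.
Proof.
elim=> {d f} [f sf|i j|i|d f1 f2 _ [g1 [sg1 fg1]] _ [g2 [sg2 fg2]]
  |d e f1 f2 sf1 [g1 [sg1 fg1]] sf2 [g2 [sg2 fg2]]|d f _ [g [sg fg]]|d f f' _ [g [sg fg]] ff'].
- exists (fun k => partial k f); split=> [k|x x0].
    by apply: singular_weaken; apply: singular_smooth; exact: smooth_partial.
  by apply: has_partialsE; exact: smooth_differentiable.
- exists (fun k x => ((k == i)%:R * (x 0 j * isq x) + (k == j)%:R * (x 0 i * isq x)) +
     (- 2) * ((x 0 i * x 0 j * isq x) * (x 0 k * isq x))); split=> [k|x x0].
    apply: singularD; last first.
      by apply: singularZ; exact: (singularM (singular_angular i j) (singular_radial k)).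
    by apply: singularD; apply: singularZ; exact: singular_radial.
  apply: has_partials_ext (has_partialsM (has_partialsM (has_partials_coord i x)
    (has_partials_coord j x)) (has_partials_isq x0)) => // k /=.
  by ring.
- exists (fun k x => (k == i)%:R * isq x + (- 2) * ((x 0 i * isq x) * (x 0 k * isq x))).
  split=> [k|x x0].
    apply: singularD; first by apply: singularZ; exact: singular_isq.
    by apply: singularZ; exact: (singularM (singular_radial i) (singular_radial k)).
  apply: has_partials_ext (has_partialsM (has_partials_coord i x) (has_partials_isq x0)) => // k /=.
  by ring.
- exists (fun k x => g1 k x + g2 k x); split=> [k|x x0]; first exact: singularD.
  by apply: has_partialsD; [exact: fg1|exact: fg2].
- exists (fun k x => g1 k x * f2 x + f1 x * g2 k x); split=> [k|x x0].
    apply: singularD; first exact: (singularM (sg1 k) sf2).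
    by rewrite -addnS; exact: (singularM sf1 (sg2 k)).
  by apply: has_partialsM; [exact: fg1|exact: fg2].
- by exists g; split=> // k; exact: singular_weaken.
- exists g; split=> // x x0; apply: has_partials_near (fg x x0).
  by apply: filterS (near_neq0 x0) => z; exact: ff'.
Qed.

(** The sup norm is at most the Euclidean one, so $|x|^2$ [isq x] $\le1$, which bounds the
    generators. Restricting to $|x|\le1$ gives compactness for the smooth ones and lets the exponent
    grow under weakening. *)
Lemma singular_bound d f : singular d f ->
  exists C, forall x, `|x| <= 1 -> x != 0 -> `|f x| <= C * `|x| ^- d.
Proof.
have isq_le x : x != 0 -> `|x| ^+ 2 * isq x <= 1.
  by move=> x0; rewrite ler_pdivrMr ?dot_gt0// mul1r sqr_norm_le_dot.
have isq_ge0 x : 0 <= isq x by rewrite invr_ge0 dot_ge0.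
elim=> {d f} [f sf|i j|i|d f1 f2 _ [C1 h1] _ [C2 h2]
  |d e f1 f2 _ [C1 h1] _ [C2 h2]|d f _ [C h]|d f f' _ [C h] ff'].
- have cK : compact [set x : 'rV[R]_m | `|x| <= 1].
    apply: bounded_closed_compact.
      exists 1; split => // M M1 x /= x1; exact: le_trans (ltW M1).
    exact: closed_norm_ball.
  have cf : {within [set x : 'rV[R]_m | `|x| <= 1], continuous f}.
    by apply: continuous_subspaceT; exact: smooth_continuous.
  have [M [_ HM]] := compact_bounded (continuous_compact cf cK).
  exists (M + 1) => x x1 _; rewrite expr0 invr1 mulr1.
  by apply: (HM (M + 1)); [rewrite ltrDl|exists x].
- exists 1 => x x1 x0; rewrite expr0 invr1 mulr1.
  rewrite !normrM (ger0_norm (isq_ge0 x)).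
  apply: le_trans (isq_le _ x0); rewrite ler_wpM2r// expr2.
  by apply: ler_pM => //; exact: le_coord_norm.
- exists 1 => x x1 x0; rewrite expr1 mul1r normrM (ger0_norm (isq_ge0 x)).
  have xp : 0 < `|x| by rewrite normr_gt0.
  rewrite -(ler_pM2l xp) mulfV ?gt_eqF//.
  apply: le_trans (isq_le _ x0); rewrite mulrA ler_wpM2r// expr2 ler_pM2l//.
  exact: le_coord_norm.
- exists (C1 + C2) => x x1 x0; rewrite (le_trans (ler_normD _ _))// mulrDl.
  by apply: lerD; [exact: h1|exact: h2].
- exists (C1 * C2) => x x1 x0; rewrite normrM.
  apply: (le_trans (ler_pM (normr_ge0 _) (normr_ge0 _) (h1 x x1 x0) (h2 x x1 x0))).
  by rewrite exprD invfM mulrACA.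
- exists C => x x1 x0; apply: (le_trans (h x x1 x0)).
  have xp : 0 < `|x| by rewrite normr_gt0.
  have C0 : 0 <= C by have := le_trans (normr_ge0 _) (h x x1 x0);
    rewrite pmulr_lge0// invr_gt0 exprn_gt0.
  rewrite ler_wpM2l// lef_pV2 ?posrE ?exprn_gt0// exprS ler_piMl// exprn_ge0//.
- by exists C => x x1 x0; rewrite -ff'// h.
Qed.

Lemma le_integral_lty f g : measurable_fun setT f -> measurable_fun setT g ->
  (\int[mu]_(x in B) (g x)%:E < +oo)%E -> (forall x, 0 <= g x) ->
  (forall x, B x -> x != 0 -> `|f x| <= g x) -> (0 < m)%N ->
  mu.-integrable B (EFin \o f).
Proof.
move=> mf mg ig g0 fg m0; have mB := @measurable_unit_ball R m.
apply/integrableP; split; first by apply/measurable_EFinP; exact: measurable_funTS.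
apply: le_lt_trans ig; apply: ae_ge0_le_integral => //.
- by apply/measurable_EFinP; apply: measurableT_comp => //; exact: measurable_funTS.
- by move=> x _; rewrite lee_fin.
- by apply/measurable_EFinP; exact: measurable_funTS.
- apply: lebesgue_rV_neq0 => // x x0 Bx /=.
  by rewrite lee_fin; exact: fg.
Qed.

Context (m4 : (4 < m)%N).

Lemma norm4_unit_ball_lty C : 0 <= C -> (\int[mu]_(x in B) (C * `|x|%R ^- 4)%R%:E < +oo)%E.
Proof.
move=> C0; have mB := @measurable_unit_ball R m.
under eq_integral do rewrite EFinM.
have mn : measurable_fun setT (fun x : 'rV[R]_m => `|x| ^- 4) by exact: measurable_norm_expV.
rewrite ge0_integralZl//; last by apply/measurable_EFinP; exact: measurable_funTS.
apply: lte_mul_pinfty => //.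
apply: le_lt_trans (integral_norm4_lty m4).
apply: ge0_subset_integral => //.
- by apply: closed_measurable_rV; exact: closed_norm_ball.
- by apply/measurable_EFinP; exact: measurable_funTS.
- by move=> x; exact: unit_ball_norm.
Qed.

Lemma singular_integrable d f : (d <= 4)%N -> singular d f ->
  mu.-integrable B (EFin \o f).
Proof.
move=> d4 /(singular_le d4) sf; have [C hC] := singular_bound sf.
apply: (@le_integral_lty _ (fun x => `|C| * `|x| ^- 4)).
- exact: singular_measurable sf.
- by apply: measurable_funM => //; exact: measurable_norm_expV.
- exact: norm4_unit_ball_lty.
- by move=> x; rewrite mulr_ge0// invr_ge0.
- move=> x Bx x0; apply: le_trans (hC x (unit_ball_norm Bx) x0) _.
  by rewrite ler_wpM2r ?invr_ge0// ler_norm.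
- exact: leq_trans m4.
Qed.

Lemma singular_square_integrable d f : (d <= 2)%N -> singular d f -> square_integrable B f.
Proof.
move=> d2 sf; split; first by apply: measurable_funTS; exact: singular_measurable sf.
have sff := singularM sf sf.
have /integrableP[_] : mu.-integrable B (EFin \o (fun x => f x * f x)).
  by apply: singular_integrable sff; exact: (leq_add d2 d2).
apply: le_lt_trans; rewrite le_eqVlt; apply/orP; left; apply/eqP.
by apply: eq_integral => x _ /=; rewrite -expr2 ger0_norm ?sqr_ge0.
Qed.

Lemma singular_locally_integrable d f : (d <= 4)%N -> singular d f ->
  locally_integrable_rV B f.
Proof.
move=> d4 sf; have /integrableP[mf fi] := singular_integrable d4 sf.
split=> [|K cK KB]; first by apply: measurable_funTS; exact: singular_measurable sf.
apply: le_lt_trans fi; apply: ge0_subset_integral => //.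
- by apply: closed_measurable_rV; exact: compact_closed.
- exact: measurable_unit_ball.
- by apply/measurable_EFinP; apply: measurableT_comp => //;
  apply: measurable_funTS; exact: singular_measurable sf.
Qed.

End singular_functions.

(** * Integration by parts across the origin and weak derivatives *)

Section divergence.
Context {R : realType} {m : nat}.
Context (m4 : (4 < m)%N).
Local Notation mu := (@lebesgue_rV R m).
Local Notation B := (@unit_ball R m).
Implicit Types (f g h phi F : 'rV[R]_m -> R) (x : 'rV[R]_m) (i j k l : 'I_m) (d e : nat).

Definition punctured_partial k f g :=
  forall x, x != 0 -> differentiable f x /\ partial k f x = g x.

Lemma set_coordK k x s t : set_coord k (set_coord k x s) t = set_coord k x t.
Proof. by apply/rowP => i; rewrite !mxE; case: ifP => // ->. Qed.

Lemma is_derive_line k f g x t : set_coord k x t != 0 -> punctured_partial k f g ->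
  is_derive t 1 (fun s => f (set_coord k x s)) (g (set_coord k x t)).
Proof.
move=> xt0 /(_ _ xt0)[df <-].
have := has_partials_line k (has_partialsE df).
by rewrite mxE eqxx; under eq_fun do rewrite set_coordK.
Qed.

(* Almost every line in direction [k] misses the origin, and [F] restricted to
   it is a compactly supported [C^1] function: no cut-off at the origin is
   needed. *)
Lemma integral_partial_eq0 k d F g (K : set 'rV[R]_m) :
  (d <= 4)%N -> singular d g -> punctured_partial k F g ->
  compact K -> K `<=` B -> (forall x, ~ K x -> F x = 0) ->
  \int[mu]_(x in B) g x = 0.
Proof.
move=> d4 sg Fg cK KB F0.
have [i ik] : exists i, i != k.
  case: m k m4 {F g d d4 sg Fg cK KB F0 K} => [|[|n]]// k _.
  have [->|k0] := eqVneq k ord0; first by exists (lift ord0 ord0).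
  by exists ord0; rewrite eq_sym.
have mB := @measurable_unit_ball R m.
(* [integral_lines_eq0] asks for every line. The line in direction [k] through the origin lies in
   this null hyperplane, so after deleting it the integrand is zero on that line. *)
pose N := [set x : 'rV[R]_m | x 0 i = 0].
have mN : measurable N.
  by have := @measurable_coord _ R m i measurableT [set 0] (measurable_set1 _); rewrite setTI.
have ig := singular_integrable m4 d4 sg.
rewrite /Rintegral (negligible_integral mN)//; last exact: lebesgue_rV_hyperplane.
rewrite integral_mkcond (@integral_lines_eq0 _ _ k)//.
  apply/(integrable_mkcond _ _).1; first exact: measurableD.
  by apply: integrableS ig => //; exact: measurableD.
move=> x; have [xi|/eqP xi] := eqVneq (x 0 i) 0.
  transitivity (\int[@lebesgue_measure R]_t (cst (0 : \bar R)) t)%E; last exact: integral0.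
  apply: eq_integral => t _; rewrite patchE memNset//= => -[_]; apply.
  by rewrite /N/= mxE (negPf ik).
have y0 t : set_coord k x t != 0.
  by apply/eqP => /rowP/(_ i); rewrite !mxE (negPf ik).
(* Off the ball [F] vanishes in a neighbourhood, being supported in a compact subset of it. *)
have FK t : ~ B (set_coord k x t) -> g (set_coord k x t) = 0.
  move=> yB; have [_ <-] := Fg _ (y0 t).
  by apply: (partial_off_compact _ cK F0) => /KB.
have out t : 1 <= `|t| -> ~ B (set_coord k x t).
  move=> t1 /unit_ballE; apply/negP; rewrite -leNgt.
  apply: le_trans (sqr_coord_le_dot _ k); rewrite mxE eqxx -real_normK ?num_real//.
  by rewrite exprn_ege1.
(* The line meets the ball only for $|t|<1$, so $[-1,1]$ is large enough and [F] vanishes at both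
   ends. *)
rewrite [LHS](_ : _ = \int[@lebesgue_measure R]_(t in `[(-1)%R, 1%R]) (g (set_coord k x t))%:E)%E; last first.
  rewrite [RHS]integral_mkcond; apply: eq_integral => t _; rewrite !patchE.
  have [t1|t1] := leP `|t| 1.
    rewrite [t \in _]mem_set/=; last by rewrite in_itv/= -ler_norml.
    have [yB|yB] := pselect ((B `\` N) (set_coord k x t)); first by rewrite mem_set.
    rewrite memNset// FK// => By; apply: yB; split=> //.
    by rewrite /N/= mxE (negPf ik).
  rewrite [t \in _]memNset/=; last by rewrite in_itv/= -ler_norml leNgt t1.
  by rewrite memNset// => -[By _]; apply: (out t) => //; exact: ltW.
have dF t := is_derive_line (y0 t) Fg.
(* The fundamental theorem needs a continuous integrand; [g] is even differentiable along the line,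
   being singular of some order. *)
have [g' [_ gg']] := singular_partials sg.
have cg : continuous (fun t => g (set_coord k x t)).
  move=> t; apply: differentiable_continuous; apply/derivable1_diffP.
  have gk : punctured_partial k g (g' k) by move=> z z0; have [] := gg' z z0.
  by have [] := is_derive_line (y0 t) gk.
have cF : continuous (fun t => F (set_coord k x t)).
  by move=> t; apply: differentiable_continuous; apply/derivable1_diffP; have [] := dF t.
rewrite (@continuous_FTC2 _ _ (fun t => F (set_coord k x t)))//.
- rewrite !F0 ?subee// => /KB; apply: out; by rewrite ?normrN normr1.
- exact: continuous_subspaceT.
- split.
  + by move=> t _; have [] := dF t.
  + by apply: cvg_at_right_filter; exact: cF.
  + by apply: cvg_at_left_filter; exact: cF.
- by move=> t _; rewrite derive1E; have [_ ->] := dF t.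
Qed.

Lemma test_function_singular phi : test_function B phi -> singular 0 phi.
Proof. by move=> [sphi _]; exact: singular_smooth. Qed.

Lemma test_function_partial k phi : test_function B phi -> test_function B (partial k phi).
Proof.
move=> [sphi [K [cK KB phi0]]]; split; first exact: smooth_partial.
by exists K; split=> // x; exact: partial_off_compact.
Qed.

Lemma locally_integrable_test f phi : locally_integrable_rV B f -> test_function B phi ->
  mu.-integrable B (EFin \o (fun x => f x * phi x)).
Proof.
move=> [mf fK] [sphi [K [cK KB phi0]]].
have mB := @measurable_unit_ball R m.
have mK : measurable K by apply: closed_measurable_rV; exact: compact_closed.
have cphi : {within K, continuous phi}.
  by apply: continuous_subspaceT; exact: smooth_continuous.
have [M [_ HM]] := compact_bounded (continuous_compact cphi cK).
have phiM x : K x -> `|phi x| <= `|M| + 1.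
  move=> Kx; apply: (HM (`|M| + 1)); last by exists x.
  by rewrite (le_lt_trans (ler_norm M))// ltrDl.
have mfK : measurable_fun K f by exact: measurable_funS mf.
apply/integrableP; split.
  apply/measurable_EFinP; apply: measurable_funM => //.
  by apply: measurable_funTS; exact: smooth_measurable.
rewrite (_ : (\int[mu]_(x in B) _)%E = (\int[mu]_(x in K) `|f x * phi x|%:E)%E); last first.
  rewrite [LHS]integral_mkcond [RHS]integral_mkcond; apply: eq_integral => x _ /=;
    rewrite !patchE.
  have [Kx|Kx] := pselect (K x); first by rewrite !mem_set//; exact: KB.
  by rewrite [x \in K]memNset// phi0// mulr0 normr0; case: ifP.
apply: (@le_lt_trans _ _ (\int[mu]_(x in K) ((`|M| + 1)%:E * `|f x|%:E))%E).
  apply: ge0_le_integral => //.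
  - apply/measurable_EFinP; apply: measurableT_comp => //; apply: measurable_funM => //.
    by apply: measurable_funTS; exact: smooth_measurable.
  - by apply/measurable_EFinP; apply: measurable_funM => //; exact: measurableT_comp.
  - by move=> x Kx; rewrite -EFinM lee_fin normrM mulrC ler_wpM2r// phiM.
rewrite ge0_integralZl//.
- by apply: lte_mul_pinfty => //; exact: fK.
- by apply/measurable_EFinP; exact: measurableT_comp.
Qed.

(** The defining identity says that the integral of $\partial_k(f\varphi)$ vanishes, and this
    derivative has order $d+1\le4$. *)
Lemma is_weak_partial_singular k d f g : (d < 4)%N -> singular d f -> singular d.+1 g ->
  punctured_partial k f g -> is_weak_partial B k f g.
Proof.
move=> d4 sf sg fg.
have lf := singular_locally_integrable m4 (ltnW d4) sf.
have lg := singular_locally_integrable m4 d4 sg.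
split=> // phi tphi; have [sphi [K [cK KB phi0]]] := tphi.
have sphi0 := test_function_singular tphi.
have dsphi0 := test_function_singular (test_function_partial k tphi).
have sum : singular d.+1 (fun x => f x * partial k phi x + g x * phi x).
  apply: singularD.
    by apply: singular_weaken; rewrite -[d]addn0; exact: singularM.
  by rewrite -[d.+1]addn0; exact: singularM.
have := @integral_partial_eq0 k _ (fun x => f x * phi x) _ K d4 sum.
rewrite RintegralD//; last 3 first.
- exact: measurable_unit_ball.
- by apply: locally_integrable_test => //; exact: test_function_partial.
- exact: locally_integrable_test.
move=> H; apply/eqP; rewrite -addr_eq0; apply/eqP; apply: H => // [x x0|x Kx].
  have [df fgx] := fg x x0.
  have [D E] := has_partialsM (has_partialsE df) (has_partialsE (smooth_differentiable x sphi)).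
  by split=> //; rewrite E fgx addrC.
by rewrite phi0// mulr0.
Qed.

Lemma weak_partialP k f g : is_weak_partial B k f g -> is_weak_partial B k f (weak_partial B k f).
Proof. by move=> fg;
  apply: (@xgetPex _ (cst 0) [set g | is_weak_partial B k f g]); exists g. Qed.

Lemma locally_integrableB f g : locally_integrable_rV B f -> locally_integrable_rV B g ->
  locally_integrable_rV B (fun x => f x - g x).
Proof.
move=> [mf fi] [mg gi]; split=> [|K cK KB]; first exact: measurable_funB.
have mB := @measurable_unit_ball R m.
have mK : measurable K by apply: closed_measurable_rV; exact: compact_closed.
have mfK : measurable_fun K f by exact: measurable_funS mf.
have mgK : measurable_fun K g by exact: measurable_funS mg.
apply: (@le_lt_trans _ _ (\int[mu]_(x in K) (`|f x|%:E + `|g x|%:E))%E).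
  apply: ge0_le_integral => //.
  - by apply/measurable_EFinP; apply: measurableT_comp => //; exact: measurable_funB.
  - by apply: emeasurable_funD; apply/measurable_EFinP; exact: measurableT_comp.
  - by move=> x _; rewrite -EFinD lee_fin ler_normB.
rewrite ge0_integralD//; first by rewrite lte_add_pinfty// ?fi// gi.
- by apply/measurable_EFinP; exact: measurableT_comp.
- by apply/measurable_EFinP; exact: measurableT_comp.
Qed.

Lemma weak_partial_unique k f g h : is_weak_partial B k f g -> is_weak_partial B k f h ->
  {ae mu, forall x, B x -> g x = h x}.
Proof.
move=> [_ lg fg] [_ lh fh].
have : {ae mu, forall x, B x -> g x - h x = 0}.
  apply: du_bois_reymond; first exact: locally_integrableB.
  move=> phi tphi; under eq_Rintegral do rewrite mulrBl.
  rewrite RintegralB//; first last.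
  - exact: locally_integrable_test.
  - exact: locally_integrable_test.
  - exact: measurable_unit_ball.
  - by apply/eqP; rewrite subr_eq0 -eqr_opp -fg// -fh.
by apply: filterS => x gh Bx; apply/eqP; rewrite -subr_eq0; apply/eqP; exact: gh.
Qed.

Lemma weak_partial_ae k f g : is_weak_partial B k f g ->
  {ae mu, forall x, B x -> weak_partial B k f x = g x}.
Proof. by move=> fg; apply: weak_partial_unique (weak_partialP fg) fg. Qed.

(** The representative chosen by [weak_partial] agrees with [g] only almost everywhere, which
    integrals against test functions do not see. This gives access to second weak derivatives. *)
Lemma is_weak_partial_weak_partial k l f g h : is_weak_partial B k f g ->
  is_weak_partial B l g h -> is_weak_partial B l (weak_partial B k f) h.
Proof.
move=> fg [lg lh gh].
have [_ lf' _] := weak_partialP fg; split=> // phi tphi.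
rewrite -gh//; congr fine; apply: ae_eq_integral.
- exact: measurable_unit_ball.
- have /integrableP[] := locally_integrable_test lf' (test_function_partial l tphi).
  by [].
- have /integrableP[] := locally_integrable_test lg (test_function_partial l tphi).
  by [].
- by have := weak_partial_ae fg; apply: filterS => x E Bx; rewrite E.
Qed.

End divergence.

(** * Gradients and Laplacians off the origin *)

Section jets.
Context {R : realType} {m : nat}.
Local Notation mu := (@lebesgue_rV R m).
Local Notation B := (@unit_ball R m).
Implicit Types (f g L phi : 'rV[R]_m -> R) (x : 'rV[R]_m) (i j k l : 'I_m) (d e : nat)
  (G : 'I_m -> 'rV[R]_m -> R).

Lemma punctured_partial_unique k f f' g g' : (forall x, x != 0 -> f x = f' x) ->
  punctured_partial k f g -> punctured_partial k f' g' -> forall x, x != 0 -> g x = g' x.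
Proof.
move=> ff' fg fg' x x0; have [_ <-] := fg x x0; have [_ <-] := fg' x x0.
by apply: near_eq_derive; apply: filterS (near_neq0 x0) => z; exact: ff'.
Qed.

(** Off the origin any derivative agrees with the one from [singular_partials], so an explicit
    formula gets its order for free. *)
Lemma singular_punctured d k f g : singular d f -> punctured_partial k f g -> singular d.+1 g.
Proof.
move=> /singular_partials[g' [sg' fg']] fg; apply: singular_eq (sg' k) _.
apply: (@punctured_partial_unique k f f) => // x x0.
by have [df fgx] := fg' x x0.
Qed.

Lemma punctured_partial_exists d k f : singular d f ->
  exists g, singular d.+1 g /\ punctured_partial k f g.
Proof.
move=> /singular_partials[g [sg fg]]; exists (g k); split=> // x x0.
by have [] := fg x x0.
Qed.

Lemma punctured_partialD k f f' g g' : punctured_partial k f g -> punctured_partial k f' g' ->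
  punctured_partial k (fun x => f x + f' x) (fun x => g x + g' x).
Proof.
move=> fg fg' x x0; have [df <-] := fg x x0; have [df' <-] := fg' x x0.
by have [? ->] := has_partialsD (has_partialsE df) (has_partialsE df').
Qed.

Lemma punctured_partialM k f f' g g' : punctured_partial k f g -> punctured_partial k f' g' ->
  punctured_partial k (fun x => f x * f' x) (fun x => g x * f' x + f x * g' x).
Proof.
move=> fg fg' x x0; have [df <-] := fg x x0; have [df' <-] := fg' x x0.
by have [? ->] := has_partialsM (has_partialsE df) (has_partialsE df').
Qed.

Lemma punctured_partial_cst k (c : R) : punctured_partial k (fun=> c) (fun=> 0).
Proof. by move=> x _; have [? ->] := has_partials_cst c x. Qed.

Lemma punctured_partial_smooth k phi : smooth phi -> punctured_partial k phi (partial k phi).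
Proof. by move=> sphi x _; split=> //; exact: smooth_differentiable. Qed.

(* [G] is the gradient and [L] the laplacian of [f] off the origin. *)
Definition jet f G L := exists2 H : 'I_m -> 'rV[R]_m -> R,
  (forall k, punctured_partial k f (G k)) /\ (forall k, punctured_partial k (G k) (H k)) &
  forall x, x != 0 -> L x = \sum_k H k x.

Lemma jet_ext f f' G L L' : jet f G L -> (forall x, f x = f' x) ->
  (forall x, x != 0 -> L x = L' x) -> jet f' G L'.
Proof. by move=> [H GH LH] /funext <- LL'; exists H => // x x0; rewrite -LL'// LH. Qed.

(** The tool for differentiating an identity: the jets of its two sides, computed by the rules
    below, must agree. *)
Lemma jet_unique f f' G G' L L' : (forall x, x != 0 -> f x = f' x) ->
  jet f G L -> jet f' G' L' ->
  forall x, x != 0 -> (forall k, G k x = G' k x) /\ L x = L' x.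
Proof.
move=> ff' [H [fG GH] LH] [H' [fG' GH'] LH'] x x0.
have GG' k := punctured_partial_unique ff' (fG k) (fG' k).
split=> [k|]; first exact: GG'.
rewrite LH// LH'//; apply: eq_bigr => k _.
exact: punctured_partial_unique (GG' k) (GH k) (GH' k) _ x0.
Qed.

Lemma jet_singular d f G L : singular d f -> jet f G L ->
  (forall k, singular d.+1 (G k)) /\ singular d.+2 L.
Proof.
move=> sf [H [fG GH] LH]; have sG k := singular_punctured sf (fG k).
split=> //; apply: (@singular_eq _ _ _ (fun x => \sum_k H k x)).
  by apply: singular_sum => k; exact: singular_punctured (sG k) (GH k).
by move=> x x0; rewrite LH.
Qed.

Lemma jet_cst (c : R) : jet (fun=> c) (fun _ _ => 0) (fun=> 0).
Proof.
exists (fun _ _ => 0); first by split=> k; exact: punctured_partial_cst.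
by move=> x _; rewrite big1.
Qed.

Lemma jet_coord i : jet (fun x => x 0 i) (fun k _ => (k == i)%:R) (fun=> 0).
Proof.
exists (fun _ _ => 0); last by move=> x _; rewrite big1.
split=> k; last exact: punctured_partial_cst.
by move=> x _; have [? ->] := has_partials_coord i x.
Qed.

Lemma jet_smooth phi : smooth phi -> jet phi (fun k => partial k phi) (laplacian phi).
Proof.
move=> sphi; exists (fun k => partial k (partial k phi)) => //.
by split=> k; apply: punctured_partial_smooth => //; exact: smooth_partial.
Qed.

Lemma jetD f f' G G' L L' : jet f G L -> jet f' G' L' ->
  jet (fun x => f x + f' x) (fun k x => G k x + G' k x) (fun x => L x + L' x).
Proof.
move=> [H [fG GH] LH] [H' [fG' GH'] LH']; exists (fun k x => H k x + H' k x).
  by split=> k; exact: punctured_partialD.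
by move=> x x0; rewrite big_split/= LH// LH'.
Qed.

Lemma jetM f f' G G' L L' : jet f G L -> jet f' G' L' ->
  jet (fun x => f x * f' x) (fun k x => G k x * f' x + f x * G' k x)
    (fun x => L x * f' x + 2 * (\sum_k G k x * G' k x) + f x * L' x).
Proof.
move=> [H [fG GH] LH] [H' [fG' GH'] LH'].
exists (fun k x => (H k x * f' x + G k x * G' k x) + (G k x * G' k x + f x * H' k x)).
  split=> k; first exact: punctured_partialM.
  by apply: punctured_partialD; exact: punctured_partialM.
move=> x x0; rewrite LH// LH'// !big_split/= -mulr_suml -mulr_sumr; ring.
Qed.

Lemma jetZ (c : R) f G L : jet f G L ->
  jet (fun x => c * f x) (fun k x => c * G k x) (fun x => c * L x).
Proof.
move=> [H [fG GH] LH]; exists (fun k x => c * H k x).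
  split=> k x x0.
    have [D E] := punctured_partialM (punctured_partial_cst k c) (fG k) x0.
    by split=> //; rewrite E mul0r add0r.
  have [D E] := punctured_partialM (punctured_partial_cst k c) (GH k) x0.
  by split=> //; rewrite E mul0r add0r.
by move=> x x0; rewrite LH// mulr_sumr.
Qed.

Lemma jet_sum (I : Type) (r : seq I) (F : I -> 'rV[R]_m -> R)
    (G : I -> 'I_m -> 'rV[R]_m -> R) (L : I -> 'rV[R]_m -> R) :
  (forall J, jet (F J) (G J) (L J)) ->
  jet (fun x => \sum_(J <- r) F J x) (fun k x => \sum_(J <- r) G J k x)
    (fun x => \sum_(J <- r) L J x).
Proof.
move=> FJ; elim: r => [|J r IH].
  have := jet_cst 0; congr jet; first by apply/funext => x; rewrite big_nil.
    by apply/funext => k; apply/funext => x; rewrite big_nil.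
  by apply/funext => x; rewrite big_nil.
have := jetD (FJ J) IH; congr jet; first by apply/funext => x; rewrite big_cons.
  by apply/funext => k; apply/funext => x; rewrite big_cons.
by apply/funext => x; rewrite big_cons.
Qed.

Lemma sum_delta (F : 'I_m -> R) i : \sum_k (k == i)%:R * F k = F i.
Proof.
rewrite (bigD1 i)//= eqxx mul1r big1 ?addr0// => k ki.
by rewrite (negPf ki) mul0r.
Qed.

Lemma sum_sqr_isq x : x != 0 -> \sum_k x 0 k * x 0 k * isq x = 1.
Proof. by move=> x0; rewrite -mulr_suml -/(dot x x) mulfV// gt_eqF// dot_gt0. Qed.

(** The case $p=-2$ of $\Delta r^p=p(p+m-2)r^{p-2}$. *)
Lemma jet_isq : jet isq (fun k x => - 2 * (x 0 k * isq x) * isq x)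
  (fun x => (8 - 2 * m%:R) * isq x ^+ 2).
Proof.
have I k : punctured_partial k isq (fun x => - 2 * (x 0 k * isq x) * isq x).
  by move=> x x0; have [? ->] := has_partials_isq x0.
pose H k x := (0 * (x 0 k * isq x) + - 2 * ((k == k)%:R * isq x + x 0 k *
  (- 2 * (x 0 k * isq x) * isq x))) * isq x + (- 2 * (x 0 k * isq x)) *
  (- 2 * (x 0 k * isq x) * isq x).
exists H.
  split=> // k; apply: punctured_partialM => //; apply: punctured_partialM.
    exact: punctured_partial_cst.
  apply: punctured_partialM => //.
  by move=> x _; have [? ->] := has_partials_coord k x.
move=> x x0; rewrite /H.
rewrite (eq_bigr (fun k => - 2 * isq x ^+ 2 + (8 * isq x ^+ 2) * (x 0 k * x 0 k * isq x))).
  rewrite big_split/= sumr_const card_ord -mulr_sumr sum_sqr_isq// -mulr_natr; ring.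
by move=> k _; rewrite eqxx /= mulr1n; ring.
Qed.

(** In the Laplacian of $x_ix_j\cdot r^{-2}$ the cross term contributes $-8$ and $\Delta r^{-2}$
    contributes $8-2m$ to the coefficient of $x_ix_jr^{-4}$. The last clause is Euler's identity for
    homogeneity of degree 0. *)
Lemma jet_angular i j : exists2 G, jet (fun x => x 0 i * x 0 j * isq x) G
    (fun x => 2 * (i == j)%:R * isq x - 2 * m%:R * isq x * (x 0 i * x 0 j * isq x)) &
  forall x, x != 0 -> \sum_k x 0 k * G k x = 0.
Proof.
have J := jetM (jetM (jet_coord i) (jet_coord j)) jet_isq.
eexists; first apply: (jet_ext J) => // x x0 /=.
  have -> : \sum_k ((k == i)%:R * (k == j)%:R : R) = (i == j)%:R by rewrite sum_delta.
  have -> : \sum_k (((k == i)%:R * x 0 j + x 0 i * (k == j)%:R) * (- 2 * (x 0 k * isq x) * isq x)) =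
     - 4 * x 0 i * x 0 j * isq x ^+ 2.
    transitivity (\sum_k (k == i)%:R * (x 0 j * (- 2 * (x 0 k * isq x) * isq x)) +
      \sum_k (k == j)%:R * (x 0 i * (- 2 * (x 0 k * isq x) * isq x))).
      by rewrite -big_split/=; apply: eq_bigr => k _; ring.
    by rewrite !sum_delta; ring.
  ring.
move=> x x0 /=.
transitivity (\sum_k (k == i)%:R * (x 0 k * x 0 j * isq x) +
   \sum_k (k == j)%:R * (x 0 k * x 0 i * isq x) +
   (- 2 * x 0 i * x 0 j * isq x) * \sum_k x 0 k * x 0 k * isq x).
  by rewrite mulr_sumr -!big_split/=; apply: eq_bigr => k _; ring.
by rewrite !sum_delta sum_sqr_isq//; ring.
Qed.

Context (m4 : (4 < m)%N).

(** The first half keeps integrability at hand, without which vanishing integrals could not be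
    added. *)
Definition null_integral g := singular 4 g /\ \int[mu]_(x in B) g x = 0.

Lemma null_integral_eq g g' : null_integral g -> (forall x, x != 0 -> g x = g' x) ->
  null_integral g'.
Proof.
move=> [sg ig] gg'; have sg' := singular_eq sg gg'; split=> //.
rewrite -ig; congr fine; apply: ae_eq_integral.
- exact: measurable_unit_ball.
- by apply/measurable_EFinP; apply: measurable_funTS; exact: singular_measurable sg'.
- by apply/measurable_EFinP; apply: measurable_funTS; exact: singular_measurable sg.
- by apply: lebesgue_rV_neq0 => [|x x0 _]; [exact: leq_trans m4|rewrite gg'].
Qed.

Lemma null_integralD g g' : null_integral g -> null_integral g' ->
  null_integral (fun x => g x + g' x).
Proof.
move=> [sg ig] [sg' ig']; split; first exact: singularD.
rewrite RintegralD ?ig ?ig' ?addr0//.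
- exact: measurable_unit_ball.
- exact: singular_integrable sg.
- exact: singular_integrable sg'.
Qed.

Lemma null_integralZ (c : R) g : null_integral g -> null_integral (fun x => c * g x).
Proof.
move=> [sg ig]; split; first exact: singularZ.
rewrite RintegralZl ?ig ?mulr0//; first exact: measurable_unit_ball.
exact: singular_integrable sg.
Qed.

Lemma null_integral_sum (I : Type) (r : seq I) (F : I -> 'rV[R]_m -> R) :
  (forall J, null_integral (F J)) -> null_integral (fun x => \sum_(J <- r) F J x).
Proof.
move=> sF; elim: r => [|J r IH].
  split; first by apply: singular_sum => J; have [] := sF J.
  by under eq_Rintegral do rewrite big_nil; rewrite /Rintegral integral0.
by under eq_fun do rewrite big_cons; exact: null_integralD.
Qed.

(** Weaker than being a test function: products with $w$ are not smooth at the origin. *)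
Definition compactly_supported phi :=
  exists K, [/\ compact K, K `<=` B & forall x, ~ K x -> phi x = 0].

Lemma null_integral_div d (F : 'I_m -> 'rV[R]_m -> R) (D : 'I_m -> 'rV[R]_m -> R) :
  (d < 4)%N -> (forall k, singular d (F k)) -> (forall k, compactly_supported (F k)) ->
  (forall k, punctured_partial k (F k) (D k)) ->
  null_integral (fun x => \sum_k D k x).
Proof.
move=> d4 sF cF FD; apply: null_integral_sum => k.
have sD := singular_punctured (sF k) (FD k).
split; first exact: singular_le d4 sD.
have [K [cK KB F0]] := cF k.
exact: (integral_partial_eq0 m4 d4 sD (FD k) cK KB F0).
Qed.

(** Green's second identity, from $f\Delta\varphi-\varphi\Delta
    f=\operatorname{div}(f\nabla\varphi-\varphi\nabla f)$. The field has order $d+e+1\le3$, so its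
    divergence stays within order 4. *)
Lemma null_integral_green d e f G L phi P Q :
  (d + e <= 2)%N -> singular d f -> jet f G L ->
  singular e phi -> jet phi P Q -> compactly_supported phi ->
  (forall k, compactly_supported (P k)) ->
  null_integral (fun x => f x * Q x - L x * phi x).
Proof.
move=> de sf Jf sphi Jphi cphi cP.
have [sG _] := jet_singular sf Jf; have [sP _] := jet_singular sphi Jphi.
have [H [fG GH] LH] := Jf; have [H' [fP PH'] QH'] := Jphi.
pose D k x := (G k x * P k x + f x * H' k x) + (- 1) * (H k x * phi x + G k x * P k x).
have nD : null_integral (fun x => \sum_k D k x).
  apply: (@null_integral_div (d + e).+1
    (fun k x => f x * P k x + (- 1) * (G k x * phi x))) => //.
  - move=> k; apply: singularD.
      by rewrite -addnS; exact: singularM.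
    by apply: singularZ; rewrite -addSn; exact: singularM.
  - move=> k; have [K [cK KB p0]] := cphi; have [K' [cK' KB' P0]] := cP k.
    exists (K `|` K'); split.
    + exact: compactU.
    + by move=> x []; [exact: KB|exact: KB'].
    + by move=> x /not_orP[Kx Kx']; rewrite p0// P0// !mulr0 addr0.
  - move=> k; apply: punctured_partialD; first exact: punctured_partialM.
    move=> x x0; have [D1 E1] := punctured_partialM (punctured_partial_cst k (- 1))
      (punctured_partialM (GH k) (fP k)) x0.
    by split=> //; rewrite E1 mul0r add0r.
apply: null_integral_eq nD _ => x x0; apply/esym.
rewrite QH'// LH// mulr_sumr mulr_suml -sumrB; apply: eq_bigr => k _.
by rewrite /D; ring.
Qed.

End jets.

(** * Components of vector-valued test functions *)

Section vector_valued.
Context {R : realType} {m : nat}.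
Implicit Types (f : 'rV[R]_m -> R) (x : 'rV[R]_m) (k : 'I_m).

Lemma derivable_component N (phi : 'rV[R]_m -> 'rV[R]_N) (v x : 'rV[R]_m) I :
  derivable phi x v -> 'D_v (component phi I) x = 'D_v phi x 0 I.
Proof.
move=> /cvg_ex[D hD]; rewrite /derive (cvg_lim _ hD)//.
apply: cvg_lim => //.
rewrite (_ : (fun h => _) = (fun M : 'rV[R]_N => M 0 I) \o
    (fun h : R => h^-1 *: ((phi \o shift x) (h *: v) - phi x))).
  by apply: continuous_cvg hD; exact: coord_continuous.
by apply/funext => h; rewrite /= /component !mxE.
Qed.

Lemma partial_component N (phi : 'rV[R]_m -> 'rV[R]_N) k x I :
  differentiable phi x -> partial k (component phi I) x = partial k phi x 0 I.
Proof. by move=> dphi; apply: derivable_component; exact: diff_derivable. Qed.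

Lemma smooth_partialv N (phi : 'rV[R]_m -> 'rV[R]_N) k : smooth phi -> smooth (partial k phi).
Proof. by move=> sphi s x; have := sphi (rcons s k) x; rewrite foldr_rcons. Qed.

Lemma partial_componentE N (phi : 'rV[R]_m -> 'rV[R]_N) k I : smooth phi ->
  partial k (component phi I) = component (partial k phi) I.
Proof.
by move=> sphi; apply/funext => x; rewrite partial_component//; exact: (sphi [::]).
Qed.

Lemma smooth_component N (phi : 'rV[R]_m -> 'rV[R]_N) I : smooth phi -> smooth (component phi I).
Proof.
move=> sphi; apply: (@smooth_coind R m (fun f => exists psi : 'rV[R]_m -> 'rV[R]_N,
  smooth psi /\ f = component psi I)); last by exists phi.
move=> _ [psi [spsi ->]]; split=> [x|k].
  apply: (@differentiable_comp _ _ _ _ psi (fun M : 'rV[R]_N => M 0 I)).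
    exact: (spsi [::]).
  exact: differentiable_coord.
by exists (partial k psi); split; [exact: smooth_partialv|exact: partial_componentE].
Qed.

Lemma laplacian_component N (phi : 'rV[R]_m -> 'rV[R]_N) x I : smooth phi ->
  laplacian (component phi I) x = laplacian phi x 0 I.
Proof.
move=> sphi; rewrite /laplacian summxE; apply: eq_bigr => k _.
by rewrite !partial_componentE//; exact: smooth_partialv.
Qed.

Lemma test_function_component N (D : set 'rV[R]_m) (phi : 'rV[R]_m -> 'rV[R]_N) I :
  test_function D phi -> test_function D (component phi I).
Proof.
move=> [sphi [K [cK KD phi0]]]; split; first exact: smooth_component.
by exists K; split=> // x Kx; rewrite /component phi0// mxE.
Qed.

Lemma partial_scale N f (c : 'rV[R]_N) k x : differentiable f x ->
  partial k (fun y => f y *: c) x = partial k f x *: c.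
Proof.
move=> df; have /cvg_ex[D hD] : derivable f x (delta_mx 0 k) by exact: diff_derivable.
rewrite /partial /derive (cvg_lim _ hD)//; apply: cvg_lim => //.

rewrite (_ : (fun h => _) =
  (fun h : R => (h^-1 *: ((f \o shift x) (h *: delta_mx 0 k) - f x)) *: c)).
  exact: cvgZr_tmp.
by apply/funext => h /=; rewrite -scalerBl scalerA.
Qed.

Lemma smooth_scale N f (c : 'rV[R]_N) : smooth f -> smooth (fun y => f y *: c).
Proof.
move=> sf s; elim/last_ind: s f sf => [|s k IH] f sf x /=.
  by apply: differentiableZl; exact: smooth_differentiable.
rewrite foldr_rcons (_ : partial k _ = fun y => partial k f y *: c).
  by apply: IH; exact: smooth_partial.
by apply/funext => y; rewrite partial_scale//; exact: smooth_differentiable.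
Qed.

Lemma test_function_scale N (D : set 'rV[R]_m) f (c : 'rV[R]_N) :
  test_function D f -> test_function D (fun y => f y *: c).
Proof.
move=> [sf [K [cK KD f0]]]; split; first exact: smooth_scale.
by exists K; split=> // x Kx; rewrite f0// scale0r.
Qed.

End vector_valued.

(** * Weak derivatives of functions of order 0 *)

Section weak_derivatives.
Context {R : realType} {m : nat} (m4 : (4 < m)%N).
Local Notation mu := (@lebesgue_rV R m).
Local Notation B := (@unit_ball R m).
Implicit Types (f g L phi : 'rV[R]_m -> R) (x : 'rV[R]_m) (k l : 'I_m)
  (G : 'I_m -> 'rV[R]_m -> R).

Lemma measurable_weak_partial k f g : is_weak_partial B k f g ->
  measurable_fun B (weak_partial B k f).
Proof. by move=> /weak_partialP[_ []]. Qed.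

Lemma square_integrable_ae f g : measurable_fun B f -> square_integrable B g ->
  {ae mu, forall x, B x -> f x = g x} -> square_integrable B f.
Proof.
move=> mf [mg ig] fg; split=> //.
rewrite (_ : (\int[mu]_(x in B) _)%E = (\int[mu]_(x in B) (g x ^+ 2)%:E)%E)//.
apply: ae_eq_integral.
- exact: measurable_unit_ball.
- by apply/measurable_EFinP; exact: measurable_funX.
- by apply/measurable_EFinP; exact: measurable_funX.
- by apply: filterS fg => x E Bx; rewrite E.
Qed.

(** Second derivatives have order 2, so their squares have order 4, which is integrable because
    $m>4$. *)
Lemma singular_W22 f : singular 0 f -> W22 B f.
Proof.
move=> sf.
have D1 k : exists g, singular 1 g /\ is_weak_partial B k f g.
  have [g [sg fg]] := punctured_partial_exists k sf.
  by exists g; split=> //; exact: (is_weak_partial_singular m4 _ sf).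
split.
- exact: singular_square_integrable sf.
- move=> k; have [g [sg fg]] := D1 k; split; first by exists g.
  apply: (square_integrable_ae (measurable_weak_partial fg) _ (weak_partial_ae fg)).
  exact: singular_square_integrable sg.
- move=> k l; have [g [sg fg]] := D1 k.
  have [h [sh gh]] := punctured_partial_exists l sg.
  have fh : is_weak_partial B l (weak_partial B k f) h.
    apply: is_weak_partial_weak_partial fg _.
    exact: (is_weak_partial_singular m4 _ sg).
  split; first by exists h.
  apply: (square_integrable_ae (measurable_weak_partial fh) _ (weak_partial_ae fh)).
  exact: singular_square_integrable sh.
Qed.

Lemma weak_partial_jet k f G L : singular 0 f -> jet f G L ->
  {ae mu, forall x, B x -> weak_partial B k f x = G k x}.
Proof.
move=> sf Jf; have [sG _] := jet_singular sf Jf; have [H [fG _] _] := Jf.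
apply: weak_partial_ae; exact: (is_weak_partial_singular m4 _ sf).
Qed.

Lemma measurable_weak_partial_jet k f G L : singular 0 f -> jet f G L ->
  measurable_fun B (weak_partial B k f).
Proof.
move=> sf Jf; have [sG _] := jet_singular sf Jf; have [H [fG _] _] := Jf.
apply: (@measurable_weak_partial _ _ (G k)); exact: (is_weak_partial_singular m4 _ sf).
Qed.

Lemma weak_laplacian_jet f G L : singular 0 f -> jet f G L ->
  measurable_fun B (weak_laplacian B f) /\
  {ae mu, forall x, B x -> weak_laplacian B f x = L x}.
Proof.
move=> sf Jf; have [sG _] := jet_singular sf Jf; have [H [fG GH] LH] := Jf.
have fH k : is_weak_partial B k (weak_partial B k f) (H k).
  apply: is_weak_partial_weak_partial.
    exact: (is_weak_partial_singular m4 _ sf (sG k)).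
  apply: (is_weak_partial_singular m4 _ (sG k)) => //.
  exact: singular_punctured (sG k) (GH k).
split.
  by apply: measurable_sum => k; exact: measurable_weak_partial (fH k).
have m0 : (0 < m)%N by exact: leq_trans m4.
have A : {ae mu, forall x k, B x -> weak_partial B k (weak_partial B k f) x = H k x}.
  by apply: filter_forall => k; exact: weak_partial_ae (fH k).
have Z : {ae mu, forall x, x != 0} by exact: lebesgue_rV_neq0.
move: A Z; apply: filterS2 => x E x0 Bx.
by rewrite LH//; apply: eq_bigr => k _; exact: E.
Qed.

End weak_derivatives.

(** * Sphere-valued maps with [Delta w = - 2 m r^-2 v] *)

Section sphere_maps.
Context {R : realType} {m : nat} (m4 : (4 < m)%N).
Local Notation mu := (@lebesgue_rV R m).
Local Notation B := (@unit_ball R m).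

(** All that is retained of [utilde]: [b] is its constant part, [a] its gradient, [s] the squared
    length of the varying part $v=w-b$, and [wr] is Euler's identity. *)
Context {N : nat} (w : 'rV[R]_m -> 'rV[R]_N) (b : 'I_N -> R) (s : R)
  (a : 'I_N -> 'I_m -> 'rV[R]_m -> R).
Let v I x := component w I x - b I.
Context (w0 : forall I, singular 0 (component w I))
  (wJ : forall I, jet (component w I) (a I) (fun x => - 2 * m%:R * isq x * v I x))
  (wr : forall I (x : 'rV[R]_m), x != 0 -> \sum_k x 0 k * a I k x = 0)
  (vv : forall x : 'rV[R]_m, x != 0 -> \sum_I v I x ^+ 2 = s)
  (ww : forall x : 'rV[R]_m, x != 0 -> dot (w x) (w x) = 1).
Implicit Types (x : 'rV[R]_m) (k : 'I_m) (I : 'I_N) (phi : 'rV[R]_m -> 'rV[R]_N).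

Let L I x := - 2 * m%:R * isq x * v I x.

Let v0 I : singular 0 (v I).
Proof. by apply: singularD; [exact: w0|exact: singular_cst]. Qed.

Let a1 I k : singular 1 (a I k).
Proof. by have [] := jet_singular (w0 I) (wJ I). Qed.

Let vJ I : jet (v I) (a I) (L I).
Proof.
have := jetD (wJ I) (jet_cst (- b I)); rewrite /=; congr jet.
- by apply/funext => k; apply/funext => x; rewrite addr0.
- by apply/funext => x; rewrite addr0.
Qed.

(** Differentiate $|v|^2=s$. The gradient gives $2\langle v,\partial_kv\rangle=0$; the Laplacian
    gives $|\nabla v|^2=-\langle v,\Delta v\rangle=2ms\,r^{-2}$. *)
Let va_aa x : x != 0 -> (forall k, \sum_I v I x * a I k x = 0) /\
  \sum_I \sum_k a I k x * a I k x = 2 * m%:R * s * isq x.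
Proof.
move=> x0.
have E y : y != 0 -> \sum_I v I y * v I y = s.
  by move=> y0; rewrite -(vv y0); apply: eq_bigr => I _; rewrite expr2.
have := jet_unique E (jet_sum (index_enum _) (fun I => jetM (vJ I) (vJ I))) (jet_cst s) x0.
move=> [Hk HL]; split=> [k|].
  have := Hk k; rewrite /= big_split/= => h.
  have : 2 * \sum_I v I x * a I k x = 0.
    rewrite -[RHS]h mulr_natl mulr2n; congr (_ + _).
    by apply: eq_bigr => I _; rewrite mulrC.
  by move/eqP; rewrite mulf_eq0 pnatr_eq0/= => /eqP.
move: HL; rewrite !big_split/= -mulr_sumr => h.
have LvE : \sum_I L I x * v I x = - 2 * m%:R * isq x * s.
  by rewrite -(E _ x0) mulr_sumr; apply: eq_bigr => I _; rewrite /L; ring.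
have vLE : \sum_I v I x * L I x = - 2 * m%:R * isq x * s.
  by rewrite -LvE; apply: eq_bigr => I _; rewrite mulrC.
move: h; rewrite LvE vLE; set S := \sum_I _ => h.
have : 2 * S = 2 * (2 * m%:R * s * isq x) by rewrite -[LHS]addr0 -[X in _ + X]oppr0 -h; ring.
by apply: mulfI; rewrite pnatr_eq0.
Qed.

Lemma sphere_map_W22 : W22_sphere w.
Proof.
split=> [I|]; first exact: singular_W22.
apply: lebesgue_rV_neq0 => [|x x0 _]; first exact: leq_trans m4.
by rewrite /unit_sphere/= /enorm ww// sqrtr1.
Qed.

Lemma sphere_map_ae : {ae mu, forall x, x != 0 /\ (B x ->
  [/\ forall k, weak_partialv B k w x = \row_I a I k x,
      weak_laplacianv B w x = \row_I L I x &
      energy_density w x = 2 * m%:R * s * isq x])}.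
Proof.
have Z : {ae mu, forall x, x != 0}.
  by apply: lebesgue_rV_neq0 => //; exact: leq_trans m4.
have A : {ae mu, forall x k I, B x -> weak_partial B k (component w I) x = a I k x}.
  apply: filter_forall => k; apply: filter_forall => I.
  exact: (weak_partial_jet m4 _ (w0 I) (wJ I)).
have A2 : {ae mu, forall x I, B x -> weak_laplacian B (component w I) x = L I x}.
  by apply: filter_forall => I; have [] := weak_laplacian_jet m4 (w0 I) (wJ I).
move: Z A A2; apply: filterS3 => x x0 E E2; split=> // Bx.
have D k : weak_partialv B k w x = \row_I a I k x.
  by apply/rowP => I; rewrite !mxE E.
split=> //; first by apply/rowP => I; rewrite !mxE E2.
have [_ <-] := va_aa x0; rewrite /energy_density exchange_big/=.
by apply: eq_bigr => I _; apply: eq_bigr => k _; rewrite D !mxE.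
Qed.

Let sphi_c phi I : test_function B phi -> smooth (component phi I).
Proof. by move=> [sphi _]; exact: smooth_component. Qed.

Let S phi x := \sum_I (s * component w I x - v I x) * component phi I x.

Let S0 phi : test_function B phi -> singular 0 (S phi).
Proof.
move=> tphi; apply: singular_sum => I.
apply: (@singularM _ _ 0 0); last by apply: singular_smooth; exact: sphi_c.
apply: singularD; first exact: singularZ.
rewrite (_ : (fun x => _) = fun x => (- 1) * v I x); first exact: singularZ.
by apply/funext => x; rewrite mulN1r.
Qed.

Lemma measurable_dot (f g : 'rV[R]_m -> 'rV[R]_N) :
  (forall I, measurable_fun B (fun x => f x 0 I)) ->
  (forall I, measurable_fun B (fun x => g x 0 I)) ->
  measurable_fun B (fun x => dot (f x) (g x)).
Proof. by move=> mf mg; apply: measurable_sum => I; exact: measurable_funM. Qed.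

Let mw I : measurable_fun B (fun x => w x 0 I).
Proof. by apply: measurable_funTS; exact: singular_measurable (w0 I). Qed.

Let mphi phi : test_function B phi -> forall I, measurable_fun B (fun x => phi x 0 I).
Proof. by move=> tphi I;
  apply: measurable_funTS; exact: (smooth_measurable (sphi_c I tphi)). Qed.

Let mdw k I : measurable_fun B (fun x => weak_partialv B k w x 0 I).
Proof.
under eq_fun do rewrite mxE.
exact: (measurable_weak_partial_jet m4 _ (w0 I) (wJ I)).
Qed.

Let mlap phi : test_function B phi -> forall I, measurable_fun B (fun x => laplacian phi x 0 I).
Proof.
move=> tphi I; have [sphi _] := tphi.
under eq_fun do rewrite -laplacian_component//.
apply: measurable_funTS; apply: measurable_sum => k; apply: smooth_measurable.
by do 2 apply: smooth_partial; exact: sphi_c.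
Qed.

Let menergy : measurable_fun B (energy_density w).
Proof. by apply: measurable_sum => k; apply: measurable_dot. Qed.

(** Green's identity moves the Laplacian from $\varphi$ to $w$, and then $\Delta w+|\nabla
    w|^2w=2m\,r^{-2}(sw-v)$. *)
Lemma sphere_map_harmonic phi : test_function B phi ->
  \int[mu]_(x in B) (dot (w x) (laplacian phi x) + energy_density w x * dot (w x) (phi x)) =
  2 * m%:R * \int[mu]_(x in B) (isq x * S phi x).
Proof.
move=> tphi; have [sphi _] := tphi.
have n1 : null_integral (fun x => \sum_I (component w I x * laplacian (component phi I) x -
    L I x * component phi I x)).
  apply: null_integral_sum => // I.
  have [_ [K [cK KB p0]]] := test_function_component I tphi.
  apply: (@null_integral_green _ _ m4 0 0 _ _ _ _ _ _ _ (w0 I) (wJ I) _ (jet_smooth (sphi_c I tphi))) => //.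
  - by apply: singular_smooth; exact: sphi_c.
  - by exists K.
  - by move=> k; exists K; split=> // x; exact: partial_off_compact.
have sS : singular 4 (fun x => isq x * S phi x).
  by apply: (@singular_le _ _ 2) => //; exact: (@singularM _ _ 2 0 _ _ singular_isq (S0 tphi)).
have mB := @measurable_unit_ball R m.
have iS := singular_integrable m4 (leqnn 4) sS.
have [sn1 in1] := n1.
transitivity (\int[mu]_(x in B) ((\sum_I (component w I x * laplacian (component phi I) x -
    L I x * component phi I x)) + 2 * m%:R * (isq x * S phi x))); last first.
  rewrite RintegralD//.
  - by rewrite in1 add0r RintegralZl.
  - exact: singular_integrable sn1.
  - exact: singular_integrable (singularZ _ sS).
congr fine; apply: ae_eq_integral => //.
- apply/measurable_EFinP; apply: measurable_funD.
    by apply: measurable_dot => // I; exact: mlap.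
  by apply: measurable_funM => //; apply: measurable_dot => // I; exact: mphi.
- apply/measurable_EFinP; apply: measurable_funTS; apply: measurable_funD.
    exact: singular_measurable sn1.
  exact: singular_measurable (singularZ _ sS).
move: sphere_map_ae; apply: filterS => x [x0 H] Bx; have [_ _ ->] := H Bx.
congr EFin; rewrite /dot /S !mulr_sumr -!big_split/=; apply: eq_bigr => I _.
by rewrite laplacian_component// /L /component; ring.
Qed.

(** The null integrals [n1], [n2], [n3] treat in turn $\langle\Delta w,\Delta\varphi\rangle$,
    $|\nabla w|^2\langle\nabla w,\nabla\varphi\rangle$ and $|\nabla w|^2\Delta\langle
    w,\varphi\rangle$. The final sum of the integrand vanishes pointwise, and what remains is of
    order zero in $\varphi$. *)
Lemma sphere_map_biharmonic phi : test_function B phi ->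
  \int[mu]_(x in B) biharmonic_integrand w phi x =
  8 * m%:R * (m%:R * s - m%:R + 2) * \int[mu]_(x in B) (isq x ^+ 2 * S phi x).
Proof.
move=> tphi; have [sphi _] := tphi.
pose e x : R := 2 * m%:R * s * isq x.
pose p I := component phi I.
have Je := jetZ (2 * m%:R * s) (@jet_isq R m).
have se : singular 2 e by apply: singularZ; exact: singular_isq.
have sp I : smooth (p I) by exact: sphi_c.
(* $\Delta(r^{-2}v)=(8-2m)r^{-4}v-2m\,r^{-4}v$; the cross term is a multiple of $x\cdot\nabla
   v=0$. *)
have n1 : null_integral (fun x => \sum_I (L I x * laplacian (p I) x -
    (- 2 * m%:R * (8 - 4 * m%:R) * isq x ^+ 2 * v I x) * p I x)).
  apply: null_integral_sum => // I.
  have [_ [K [cK KB p0]]] := test_function_component I tphi.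
  have JL := jetZ (- 2 * m%:R) (jetM (@jet_isq R m) (vJ I)).
  apply: (@null_integral_green _ _ m4 2 0 (L I) _ _ (p I) (fun k => partial k (p I))) => //.
  - by apply: (@singularM _ _ 2 0); [apply: singularZ; exact: singular_isq|exact: v0].
  - apply: (jet_ext JL) => [x|x x0]; first by rewrite /L; ring.
    have -> : \sum_k (- 2 * (x 0 k * isq x) * isq x) * a I k x = 0.
      transitivity (- 2 * isq x ^+ 2 * \sum_k x 0 k * a I k x); last by rewrite wr// mulr0.
      by rewrite mulr_sumr; apply: eq_bigr => k _; ring.
    by rewrite /L; ring.
  - by apply: singular_smooth.
  - exact: jet_smooth.
  - by exists K.
  - by move=> k; exists K; split=> // x; exact: partial_off_compact.
(* Divergence of $|\nabla w|^2\varphi_I\nabla w_I$; the part with $\nabla|\nabla w|^2$ is again a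
   multiple of $x\cdot\nabla w_I=0$. *)
have n2 : null_integral (fun x => \sum_I ((2 * m%:R * s * isq x * L I x) * p I x +
    e x * \sum_k a I k x * partial k (p I) x)).
  apply: null_integral_sum => // I.
  have [_ [K [cK KB p0]]] := test_function_component I tphi.
  have [H [_ aH] LH] := vJ I; have [_ [eG _] _] := Je.
  have eaP k := punctured_partialM (punctured_partialM (eG k) (aH k))
    (punctured_partial_smooth k (sp I)).
  have := null_integral_div m4 (isT : (3 < 4)%N) _ _ eaP => nD.
  apply: null_integral_eq (nD _ _) _ => //.
  - move=> k; apply: (@singularM _ _ 3 0); last exact: singular_smooth.
    exact: (@singularM _ _ 2 1).
  - by move=> k; exists K; split=> // x Kx; rewrite /p (p0 x Kx) mulr0.
  - move=> x x0 /=; rewrite (LH x x0) !mulr_sumr mulr_suml -big_split/=.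
    transitivity (- 4 * m%:R * s * isq x ^+ 2 * p I x * (\sum_k x 0 k * a I k x) +
      \sum_k (2 * m%:R * s * isq x * H k x * p I x + e x * (a I k x * partial k (p I) x))).
      rewrite mulr_sumr -big_split/=; apply: eq_bigr => k _.
      by rewrite /e; ring.
    by rewrite wr// mulr0 add0r.
have JW := jet_sum (index_enum _) (fun I => jetM (wJ I) (jet_smooth (sp I))).
set P := (fun k x => _) in JW; set Q := (fun x => \sum_(I <- _) (_ + _ + _)) in JW.
have sW : singular 0 (fun x => \sum_I component w I x * p I x).
  by apply: singular_sum => I; apply: (singularM (w0 I)); exact: singular_smooth.
(* Green's identity for $|\nabla w|^2$ and $\langle w,\varphi\rangle$; the latter need not be smooth
   at the origin, but it has order 0 and a jet. *)
have n3 : null_integral (fun x => e x * Q x -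
   (2 * m%:R * s * ((8 - 2 * m%:R) * isq x ^+ 2)) * \sum_I component w I x * p I x).
  have [_ [K [cK KB phi0]]] := tphi.
  have p0 I x : ~ K x -> p I x = 0 by move=> /phi0; rewrite /p /component => ->; rewrite mxE.
  apply: (@null_integral_green _ _ m4 2 0 _ _ _ _ _ _ _ se Je sW JW) => //.
  - exists K; split=> // x Kx; rewrite big1// => I _.
    by rewrite p0// mulr0.
  - move=> k; exists K; split=> // x Kx; rewrite /P big1// => I _.
    by rewrite (@partial_off_compact R m K)// ?p0// ?mulr0 ?addr0// => y; exact: p0.
have [mQ wQ] := weak_laplacian_jet m4 sW JW.
have mP k := measurable_weak_partial_jet m4 k sW JW.
(* In units of $r^{-4}$, the coefficient of $\langle w,\varphi\rangle$ is
   $8m^2s^2-4m^2s+2ms(8-2m)=sC$, and that of $\langle v,\varphi\rangle$ is $-2m(8-4m)-8m^2s=-C$. *)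
pose C : R := 8 * m%:R * (m%:R * s - m%:R + 2).
have sS : singular 4 (fun x => isq x ^+ 2 * S phi x).
  rewrite (_ : (fun x => _) = fun x => (isq x * isq x) * S phi x).
    exact: (singularM (singularM singular_isq singular_isq) (S0 tphi)).
  by apply/funext => x; rewrite expr2.
have mB := @measurable_unit_ball R m.
have iS := singular_integrable m4 (leqnn 4) sS.
(* The weights $1,-2,1$ are the coefficients of the three terms in the integrand. *)
have := null_integralD m4 (null_integralD m4 n1 (null_integralZ m4 (- 2) n2)) n3.
set g := (fun x => _ + _ + _) => -[sg ig].
transitivity (\int[mu]_(x in B) (g x + C * (isq x ^+ 2 * S phi x))); last first.
  rewrite RintegralD//.
  - by rewrite ig add0r RintegralZl.
  - exact: singular_integrable sg.
  - exact: singular_integrable (singularZ _ sS).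
congr fine; apply: ae_eq_integral => //.
- have mLw I : measurable_fun B (fun x => weak_laplacianv B w x 0 I).
    by under eq_fun do rewrite mxE; have [] := weak_laplacian_jet m4 (w0 I) (wJ I).
  have mdphi k I : measurable_fun B (fun x => partial k phi x 0 I).
    apply: measurable_funTS; have := smooth_measurable (smooth_partial k (sp I)).
    by rewrite partial_componentE.
  have mLL : measurable_fun B (fun x => dot (weak_laplacianv B w x) (weak_laplacianv B w x)).
    exact: measurable_dot.
  have mwp : measurable_fun B (fun x => dot (w x) (phi x)).
    by apply: measurable_dot => // I; exact: mphi.
  apply/measurable_EFinP; rewrite /biharmonic_integrand.
  apply: measurable_funB; [apply: measurable_funB; [apply: measurable_funD;
    [apply: measurable_funD; [apply: measurable_funB|]|]|]|].
  + by apply: measurable_dot => // I; exact: mlap.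
  + apply: measurable_funM; first exact: measurable_funM.
    by apply: measurable_sum => k; exact: measurable_dot.
  + apply: measurable_funM => //; apply: measurable_funD => //.
    by apply: measurable_funM => //; exact: measurable_funX.
  + exact: measurable_funM.
  + by apply: measurable_funM => //; exact: measurable_funM.
  + apply: measurable_funM => //; apply: measurable_sum => k; apply: measurable_funM => //.
    exact: measurable_dot.
- apply/measurable_EFinP; apply: measurable_funTS; apply: measurable_funD.
    exact: singular_measurable sg.
  exact: singular_measurable (singularZ _ sS).
move: sphere_map_ae wQ; apply: filterS2 => x [x0 H] EQ Bx; have [Edw Elap Ee] := H Bx.
have [va _] := va_aa x0.
rewrite /biharmonic_integrand Ee Elap.
have -> : weak_laplacian B (fun y => dot (w y) (phi y)) x = Q x by exact: EQ.
have E1 : dot (\row_I L I x) (laplacian phi x) = \sum_I L I x * laplacian (p I) x.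
  by apply: eq_bigr => I _; rewrite mxE laplacian_component.
have E2 : \sum_k dot (weak_partialv B k w x) (partial k phi x) =
    \sum_I \sum_k a I k x * partial k (p I) x.
  rewrite [RHS]exchange_big/=; apply: eq_bigr => k _; rewrite Edw; apply: eq_bigr => I _.
  by rewrite mxE partial_componentE.
have E3 : dot (\row_I L I x) (\row_I L I x) = 4 * m%:R ^+ 2 * isq x ^+ 2 * s.
  rewrite -(vv x0) mulr_sumr; apply: eq_bigr => I _; rewrite mxE /L; ring.
(* $\Delta w$ is a multiple of $v$, which is orthogonal to $\partial_kw=\partial_kv$. *)
have E4 : \sum_k dot (\row_I L I x) (weak_partialv B k w x) *
    weak_partial B k (fun y => dot (w y) (phi y)) x = 0.
  rewrite big1// => k _; rewrite Edw.
  have -> : dot (\row_I L I x) (\row_I a I k x) = - 2 * m%:R * isq x * \sum_I v I x * a I k x.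
    by rewrite mulr_sumr; apply: eq_bigr => I _; rewrite !mxE /L; ring.
  by rewrite va mulr0 mul0r.
rewrite E1 E2 E3 E4; congr EFin.
have E5 : dot (w x) (phi x) = \sum_I component w I x * p I x by [].
have E6 : S phi x = s * (\sum_I component w I x * p I x) - \sum_I v I x * p I x.
  by rewrite mulr_sumr -sumrB; apply: eq_bigr => I _; rewrite /p; ring.
have E7 : \sum_I (L I x * laplacian (p I) x -
    (- 2 * m%:R * (8 - 4 * m%:R) * isq x ^+ 2 * v I x) * p I x) =
  \sum_I L I x * laplacian (p I) x -
    (- 2 * m%:R * (8 - 4 * m%:R) * isq x ^+ 2) * \sum_I v I x * p I x.
  by rewrite sumrB mulr_sumr; congr (_ - _); apply: eq_bigr => I _; ring.
have E8 : \sum_I ((2 * m%:R * s * isq x * L I x) * p I x +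
    e x * \sum_k a I k x * partial k (p I) x) =
  - 4 * m%:R ^+ 2 * s * isq x ^+ 2 * (\sum_I v I x * p I x) +
    e x * \sum_I \sum_k a I k x * partial k (p I) x.
  rewrite big_split/= !mulr_sumr; congr (_ + _); apply: eq_bigr => I _; rewrite /L; ring.
rewrite /g E7 E8 E5 E6 /C /e; ring.
Qed.

End sphere_maps.

(** * The map [utilde] *)

Section positive_bump.
Context {R : realType} {m : nat} (m4 : (4 < m)%N).
Local Notation mu := (@lebesgue_rV R m).
Local Notation B := (@unit_ball R m).

Lemma lebesgue_rV_dot_ball_gt0 (r : R) : 0 < r ->
  (0 < mu [set x : 'rV[R]_m | (dot x x < r)%R])%E.
Proof.
(* Half side of an inscribed cube: $|x_i|\le\varepsilon\le1$ gives $x_i^2\le\varepsilon$, hence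
   $|x|^2\le m\varepsilon\le r/2<r$. *)
move=> r0; pose eps := Num.min 1 (r / (2 * m%:R)).
have m0 : 0 < m%:R :> R by rewrite ltr0n (leq_trans _ m4).
have e0 : 0 < eps by rewrite lt_min ltr01 divr_gt0// mulr_gt0.
pose Q := [set x : 'rV[R]_m | forall i, `[- eps, eps]%classic (x 0 i)].
have QE : mu Q = ((eps *+ 2) ^+ m)%:E.
  rewrite (@lebesgue_rV_box R m (fun=> `[- eps, eps]%classic)) => [|i];
    last exact: measurable_itv.
  rewrite (eq_bigr (fun=> (eps *+ 2)%:E)) ?prodEFin ?prodr_const ?card_ord// => i _.
  by rewrite lebesgue_measure_itv/= lte_fin gtrN// -EFinD opprK mulr2n.
apply: (@lt_le_trans _ _ (mu Q)).
  by rewrite QE lte_fin exprn_gt0// mulrn_wgt0.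
apply: le_measure; rewrite ?inE.
- apply: (@measurable_box_rV R m (fun=> `[- eps, eps]%classic)) => i; exact: measurable_itv.
- exact: measurable_dot_lt.
- move=> x Qx /=; apply: (@le_lt_trans _ _ (\sum_(i < m) r / (2 * m%:R))).
    apply: ler_sum => i _; rewrite -expr2 -real_normK ?num_real//.
    have := Qx i; rewrite /= in_itv/= -ler_norml => xe.
    have x1 : `|x 0 i| <= 1 by rewrite (le_trans xe)// ge_min lexx.
    rewrite expr2 (le_trans (ler_piMr _ x1))// (le_trans xe)// ge_min lexx orbT//.
  rewrite sumr_const card_ord -[_ *+ m]mulr_natr.
  have -> : r / (2 * m%:R) * m%:R = r / 2 by field; rewrite gt_eqF.
  lra.
Qed.

(** A nonnegative function with zero integral vanishes almost everywhere, but the ball where [g] is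
    nonzero off the origin has positive measure. *)
Lemma Rintegral_bump_neq0 (g : 'rV[R]_m -> R) (r : R) : 0 < r -> r < 1 -> singular 4 g ->
  (forall x, 0 <= g x) -> (forall x, x != 0 -> dot x x < r -> g x != 0) ->
  \int[mu]_(x in B) g x != 0.
Proof.
move=> r0 r1 sg g0 gn0; apply/eqP => ig0.
have mB := @measurable_unit_ball R m.
have ig := singular_integrable m4 (leqnn 4) sg.
have mg : measurable_fun B (EFin \o g) by move: ig => /integrableP[].
have : ae_eq mu B (EFin \o g) (cst 0%E).
  apply/ae_eq_integral_abs => //.
  rewrite (eq_integral (EFin \o g)); last by move=> x _ /=; rewrite ger0_norm.
  by rewrite -[LHS]fineK ?integrable_fin_num//; congr EFin.
have Z : {ae mu, forall x, x != 0}.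
  by apply: lebesgue_rV_neq0 => //; exact: leq_trans m4.
move=> A; have : {ae mu, forall x, ~ (dot x x < r)}.
  move: A Z; apply: filterS2 => x A x0 xr.
  have Bx : B x by apply/unit_ballE; exact: lt_trans r1.
  have := gn0 x x0 xr; have /= [->] := A Bx.
  by rewrite eqxx.
move=> [N [mN N0 sub]].
have := lebesgue_rV_dot_ball_gt0 r0; rewrite ltNge => /negP; apply.
rewrite -N0; apply: le_measure; rewrite ?inE//.
  exact: measurable_dot_lt.
by move=> x xr; apply: sub => /=; exact.
Qed.

End positive_bump.

Section utilde_map.
Context {R : realType} {m : nat} (m4 : (4 < m)%N) (alpha : R).
Local Notation w := (@utilde R m alpha).
Local Notation c := ((Num.sqrt (m%:R * (m%:R - 1)) : R)^-1).
Local Notation s := (sin alpha ^+ 2).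
Implicit Types (x : 'rV[R]_m).

Definition uij i j x : R := c * (m%:R * (x 0 i * x 0 j * isq x) - (i == j)%:R).

Lemma umapE x i j : umap x 0 (mxvec_index i j) = uij i j x.
Proof.
rewrite /umap mxvecE mxE /uij; congr (_ * _).
by rewrite addrC /enorm sqr_sqrtr ?dot_ge0.
Qed.

Lemma utildel x i j : component w (lshift 1 (mxvec_index i j)) x = sin alpha * uij i j x.
Proof. by rewrite /component /utilde row_mxEl mxE umapE. Qed.

Lemma utilder x : component w (rshift (m * m) ord0) x = cos alpha.
Proof. by rewrite /component /utilde row_mxEr mxE eqxx mulr1n. Qed.

Lemma utilde_ind (P : 'I_(m * m + 1) -> Prop) :
  (forall i j, P (lshift 1 (mxvec_index i j))) -> P (rshift (m * m) ord0) -> forall I, P I.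
Proof.
move=> Pl Pr I; case: (splitP I) => [J E|J E].
  have -> : I = lshift 1 J by exact/val_inj.
  by case/mxvec_indexP: J {E} => i j; exact: Pl.
by have -> : I = rshift (m * m) ord0 by apply/val_inj; rewrite /= E ord1.
Qed.

Lemma sum_utilde (F : 'I_(m * m + 1) -> R) :
  \sum_I F I = \sum_i \sum_j F (lshift 1 (mxvec_index i j)) + F (rshift (m * m) ord0).
Proof.
rewrite big_split_ord/= big_ord1; congr (_ + _).
by rewrite pair_big (reindex _ (curry_mxvec_bij _ _))/=; apply: eq_bigr => -[].
Qed.

(** The vector $(0,\cos\alpha)$, in the role of [b]. *)
Definition utilde_const : 'I_(m * m + 1) -> R :=
  fun I => if fintype.split I is inl _ then 0 else cos alpha.

Lemma utilde_constl J : utilde_const (lshift 1 J) = 0.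
Proof. by rewrite /utilde_const (unsplitK (inl J)). Qed.

Lemma utilde_constr : utilde_const (rshift (m * m) ord0) = cos alpha.
Proof. by rewrite /utilde_const (unsplitK (inr ord0)). Qed.

Lemma c2 : c ^+ 2 * (m%:R * (m%:R - 1)) = 1 :> R.
Proof.
have m1 : 1 < m%:R :> R by rewrite ltr1n (leq_trans _ m4).
have p : 0 < m%:R * (m%:R - 1) :> R by rewrite mulr_gt0 ?subr_gt0// (lt_trans ltr01).
by rewrite exprVn sqr_sqrtr ?ltW// mulVf// gt_eqF.
Qed.

(** $p=xx^T/r^2$ is a rank one projection, so $|mp-\mathrm{id}|^2=m^2-2m+m=m(m-1)$, which the
    normalising constant cancels. *)
Lemma sum_uij x : x != 0 -> \sum_i \sum_j uij i j x ^+ 2 = 1.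
Proof.
move=> x0; rewrite -c2.
pose h := isq x.
transitivity (c ^+ 2 * \sum_i \sum_j (m%:R ^+ 2 * ((x 0 i * x 0 i * h) * (x 0 j * x 0 j * h)) +
   (j == i)%:R * (1 - 2 * m%:R * (x 0 i * x 0 j * h)))).
  rewrite mulr_sumr; apply: eq_bigr => i _; rewrite mulr_sumr; apply: eq_bigr => j _.
  rewrite /uij [j == i]eq_sym; case: (i == j) => /=; rewrite /h; ring.
congr (_ * _).
under eq_bigr do rewrite big_split/= -mulr_sumr -mulr_sumr sum_sqr_isq// mulr1 sum_delta.
rewrite big_split/= -mulr_sumr sum_sqr_isq// sumrB sumr_const card_ord -mulr_sumr sum_sqr_isq//.
by rewrite -mulr_natr; ring.
Qed.

Lemma utilde_singular I : singular 0 (component w I).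
Proof.
elim/utilde_ind: I => [i j|].
  rewrite (_ : component _ _ = fun x => sin alpha * (c * (m%:R * (x 0 i * x 0 j * isq x) + (- (i == j)%:R)))).
    do 2 apply: singularZ; apply: singularD; last exact: singular_cst.
    by apply: singularZ; exact: singular_angular.
  by apply/funext => x; rewrite utildel.
rewrite (_ : component _ _ = fun=> cos alpha); first exact: singular_cst.
by apply/funext => x; rewrite utilder.
Qed.

(** Multiplying [jet_angular] by $m$ gives
    $\Delta(m\,x_ix_jr^{-2})=-2m\,r^{-2}(m\,x_ix_jr^{-2}-\delta_{ij})$: the shift by $-\delta_{ij}$
    is what turns the entries into solutions of $\Delta f=-2m\,r^{-2}f$. *)
Lemma utilde_jet : exists a : 'I_(m * m + 1) -> 'I_m -> 'rV[R]_m -> R, forall I,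
  jet (component w I) (a I)
    (fun x => - 2 * m%:R * isq x * (component w I x - utilde_const I)) /\
  forall x, x != 0 -> \sum_k x 0 k * a I k x = 0.
Proof.
suff H I : exists G : 'I_m -> 'rV[R]_m -> R,
    jet (component w I) G (fun x => - 2 * m%:R * isq x * (component w I x - utilde_const I)) /\
    forall x, x != 0 -> \sum_k x 0 k * G k x = 0.
  by have [a aP] := choice H; exists a.
elim/utilde_ind: I => [i j|].
  have [G JG Gr] := @jet_angular R m i j.
  have J := jetZ (sin alpha) (jetZ c (jetD (jetZ m%:R JG) (jet_cst (- (i == j)%:R)))).
  eexists; split.
    apply: (jet_ext J) => x; first by rewrite utildel.
    by move=> x0; rewrite utildel utilde_constl /uij; ring.
  move=> x x0 /=.
  transitivity (sin alpha * c * m%:R * \sum_k x 0 k * G k x); last by rewrite Gr// mulr0.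
  by rewrite mulr_sumr; apply: eq_bigr => k _; ring.
exists (fun _ _ => 0); split; last by move=> x _; rewrite big1// => k _; rewrite mulr0.
apply: (jet_ext (jet_cst (cos alpha))) => x; first by rewrite utilder.
by move=> _; rewrite utilder utilde_constr subrr mulr0.
Qed.

Lemma utilde_tangent x : x != 0 -> \sum_I (component w I x - utilde_const I) ^+ 2 = s.
Proof.
move=> x0; rewrite sum_utilde utilder utilde_constr subrr expr0n/= addr0.
rewrite -[RHS]mulr1 -(sum_uij x0) mulr_sumr; apply: eq_bigr => i _.
by rewrite mulr_sumr; apply: eq_bigr => j _; rewrite utildel utilde_constl subr0 exprMn.
Qed.

Lemma utilde_sphere x : x != 0 -> dot (w x) (w x) = 1.
Proof.
move=> x0; rewrite -(cos2Dsin2 alpha) -(utilde_tangent x0) addrC /dot !sum_utilde.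
rewrite utilder utilde_constr subrr expr0n/= addr0 -/(component w _ x) utilder expr2;
  congr (_ + _).
by do 2 apply: eq_bigr => ? _; rewrite utilde_constl subr0 expr2.
Qed.

Definition vertical_bump x : 'rV[R]_(m * m + 1) :=
  ball_bump 2^-1 x *: delta_mx 0 (rshift (m * m) ord0).

Lemma test_function_vertical_bump : test_function (@unit_ball R m) vertical_bump.
Proof.
apply: test_function_scale; apply: test_function_ball_bump.
by rewrite invf_lt1// ltr1n.
Qed.

Lemma sum_vertical_bump x :
  \sum_I (s * component w I x - (component w I x - utilde_const I)) * component vertical_bump I x =
  s * cos alpha * ball_bump 2^-1 x.
Proof.
rewrite (bigD1 (rshift (m * m) ord0))//= big1 ?addr0.
  by rewrite utilder utilde_constr subrr subr0 /component !mxE !eqxx mulr1.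
by move=> I /negPf II; rewrite /component /vertical_bump !mxE II andbF !mulr0.
Qed.

Lemma singular_isq_bump n : (n <= 2)%N ->
  singular 4 (fun x : 'rV[R]_m => isq x ^+ n * ball_bump 2^-1 x).
Proof.
have sb : singular 0 (@ball_bump R m 2^-1) by apply: singular_smooth; exact: smooth_ball_bump.
case: n => [|[|[|]]]// _.
- apply: (@singular_le _ _ 0) => //; under eq_fun do rewrite expr0 mul1r; exact: sb.
- by apply: (@singular_le _ _ 2) => //; exact: (@singularM _ _ 2 0 _ _ singular_isq sb).
- exact: (@singularM _ _ 4 0 _ _ (singularM singular_isq singular_isq) sb).
Qed.

(** The weight $r^{-2}$ serves the harmonic pairing and $r^{-4}$ the biharmonic one. *)
Lemma Rintegral_isq_bump n : (n <= 2)%N ->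
  \int[lebesgue_rV m]_(x in @unit_ball R m) (isq x ^+ n * ball_bump 2^-1 x) != 0.
Proof.
move=> n2; apply: (@Rintegral_bump_neq0 _ _ m4 _ 2^-1).
- by rewrite invr_gt0.
- by rewrite invf_lt1// ltr1n.
- exact: singular_isq_bump.
- by move=> x; rewrite mulr_ge0 ?flat_exp_ge0// exprn_ge0// invr_ge0 dot_ge0.
- move=> x x0 xr; rewrite mulf_neq0// ?gt_eqF//.
    by rewrite exprn_gt0// invr_gt0 dot_gt0.
  by apply: flat_exp_gt0; rewrite subr_gt0.
Qed.

End utilde_map.

Theorem theorem1p2 (R : realType) (m : nat) (hm : (4 < m)%N) (alpha : R)
    (halpha0 : 0 < alpha) (halpha1 : alpha < pi / 2) :
  proper_weakly_biharmonic (@utilde R m alpha) <->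
  sin alpha ^+ 2 = 1 - 2 / m%:R.
Proof.
have m0 : m%:R != 0 :> R by rewrite pnatr_eq0 -lt0n (leq_trans _ hm).
have s0 : sin alpha ^+ 2 != 0.
  rewrite expf_neq0// gt_eqF// sin_gt0_pi// halpha0/=.
  by rewrite (lt_trans halpha1)// ltr_pdivrMr// ltr_pMr ?pi_gt0// ltr1n.
have c0 : cos alpha != 0.
  rewrite gt_eqF// cos_gt0_pihalf// halpha1 andbT.
  by rewrite (lt_trans _ halpha0)// oppr_lt0 divr_gt0// pi_gt0.
have [a aP] := @utilde_jet R m alpha.
have aJ I := (aP I).1; have ar I := (aP I).2.
have w0 := @utilde_singular R m alpha.
have vv := @utilde_tangent R m hm alpha.
have ww := @utilde_sphere R m hm alpha.
have tphi0 := @test_function_vertical_bump R m.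
have mB := @measurable_unit_ball R m.
(* For the vertical bump both pairings are nonzero, since $s\cos\alpha\neq0$ on $(0,\pi/2)$; only
   the scalar prefactors can then vanish. *)
have S0 n : (n <= 2)%N -> \int[lebesgue_rV m]_(x in @unit_ball R m)
   (isq x ^+ n * \sum_I (sin alpha ^+ 2 * component (utilde alpha) I x -
     (component (utilde alpha) I x - utilde_const alpha I)) * component vertical_bump I x) != 0.
  move=> n2; under eq_Rintegral do rewrite sum_vertical_bump mulrCA.
  rewrite RintegralZl//; last exact: (singular_integrable hm (leqnn 4) (singular_isq_bump n2)).
  by rewrite mulf_neq0 ?Rintegral_isq_bump// mulf_neq0.
have nh : ~ weakly_harmonic (@utilde R m alpha).
  move=> /(_ _ tphi0); rewrite (sphere_map_harmonic hm w0 aJ vv tphi0) => /eqP.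
  have := S0 1 isT; under eq_Rintegral do rewrite expr1.
  by move=> S1; rewrite mulf_eq0 (negPf S1) orbF mulf_eq0 (negPf m0) pnatr_eq0.
have key : (sin alpha ^+ 2 = 1 - 2 / m%:R) <-> (m%:R * sin alpha ^+ 2 - m%:R + 2 = 0).
  split=> [->|h]; first by field.
  have e : m%:R * sin alpha ^+ 2 = m%:R - 2 by rewrite -[RHS]addr0 -h; ring.
  by rewrite -[LHS](mulKf m0) e; field.
(* One test map forces the scalar factor to vanish; conversely its vanishing kills the integral for
   every test map. *)
rewrite key; split=> [[[_ bih] _]|h].
  have := bih _ tphi0; rewrite (sphere_map_biharmonic hm w0 aJ ar vv tphi0) => /eqP.
  rewrite mulf_eq0 (negPf (S0 2 isT)) orbF mulf_eq0 mulf_eq0 (negPf m0) pnatr_eq0/=.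
  by move=> /eqP.
split=> //; split; first exact: (sphere_map_W22 hm w0 ww).
by move=> phi tphi; rewrite (sphere_map_biharmonic hm w0 aJ ar vv tphi) h mulr0 mul0r.
Qed.
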